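(* For every integer $k\ge1$ and every $\lambda>0$, $$(-1)^{k-1}\mathcal M^{(k)}(\lambda)>0,$$ where $\mathcal M^{(k)}$ denotes the $k$-th derivative of $\mathcal M$.
   Context: With $\psi(z)=\Gamma'(z)/\Gamma(z)$ the digamma function and $\mathrm i$ the imaginary unit, define for $t\in\mathbb R$ $$\varphi(t)=\operatorname{sech}\!\left(\frac{\pi t}{2}\right)\left[1+\frac{t^2}{2}\operatorname{Re}\!\left(\psi\!\left(1+\frac{\mathrm i t}{4}\right)-\psi\!\left(\frac12+\frac{\mathrm i t}{4}\right)\right)\right],$$ and for real $\lambda>0$ $$\mathcal M(\lambda)=\frac4\pi\int_0^{+\infty}\frac{1-\varphi(t)^\lambda}{t^2(t^2+4)}\,\mathrm dt .$$ *)

(* Defs.v *)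
From HB Require Import structures.
From mathcomp Require Import all_boot all_order all_algebra.
From mathcomp Require Import complex.
From mathcomp Require Import all_classical all_reals all_analysis.

Set Implicit Arguments.
Unset Strict Implicit.
Unset Printing Implicit Defensive.

Import Order.TTheory GRing.Theory Num.Theory.
Import numFieldNormedType.Exports.

Local Open Scope classical_set_scope.
Local Open Scope ring_scope.
Local Open Scope complex_scope.

(* [cpowR x z] is [x ^ z = exp (z ln x)] for real [x > 0] and complex [z]. *)
Definition cpowR (R : realType) (x : R) (z : R[i]) : R[i] :=
  (expR (complex.Re z * ln x))%:C *
  (cos (complex.Im z * ln x) +i* sin (complex.Im z * ln x)).

(* Euler's integral, taken componentwise. It is the Gamma function only on the
   half-plane [0 < Re z]; below, Gamma is only needed near [Re z = 1, 1/2]. *)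
Definition Gamma (R : realType) (z : R[i]) : R[i] :=
  let f x : R[i] := (expR (- x))%:C * cpowR x (z - 1) in
  (\int[lebesgue_measure]_(x in `]0%R, +oo[) complex.Re (f x)) +i*
  (\int[lebesgue_measure]_(x in `]0%R, +oo[) complex.Im (f x)).

(* The derivative is the complex one, over the field [R[i]]. *)
Definition digamma (R : realType) (z : R[i]) : R[i] :=
  derive1 (@Gamma R : R[i] -> R[i]^o) z / Gamma z.

Definition sech (R : realType) (x : R) : R := 2 / (expR x + expR (- x)).

Definition phi (R : realType) (t : R) : R :=
  sech (pi * t / 2) *
  (1 + t ^+ 2 / 2 *
       complex.Re (digamma (1 +i* (t / 4)) - digamma (2^-1 +i* (t / 4)))).

Definition calM (R : realType) (lambda : R) : R :=
  4 / pi * \int[lebesgue_measure]_(t in `]0%R, +oo[)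
             ((1 - phi t `^ lambda) / (t ^+ 2 * (t ^+ 2 + 4))).

(* Main.v *)
Require Import Defs.
From mathcomp Require Import all_boot all_order all_algebra.
From mathcomp Require Import complex.
From mathcomp Require Import all_classical all_reals all_analysis.
From mathcomp Require Import measurable_realfun lebesgue_integral_under.
From mathcomp Require Import ring lra zify.

Set Implicit Arguments.
Unset Strict Implicit.
Unset Printing Implicit Defensive.

Import Order.TTheory GRing.Theory Num.Theory.
Import numFieldNormedType.Exports.

Local Open Scope classical_set_scope.
Local Open Scope ring_scope.

(** Differentiating under the integral sign, the k-th derivative of [calM] is
    -(4 / pi) times the integral of (ln phi)^k phi^lambda / (t^2 (t^2 + 4)),
    whose sign is (-1)^(k-1) as soon as phi < 1 for t > 0. With -ln phi = L,
    the domination L^k e^(-c L) <= K (1 - phi) <= K C t^2 cancels the pole at 0.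

    Both phi < 1 and 1 - phi <= C t^2 follow from |D(b)| <= 3 / 2, where
    D(b) = Re (psi (1 + i b) - psi (1/2 + i b)), because cosh (pi t / 2)
    dominates 1 + pi^2 t^2 / 8 and pi^2 >= 8. The recurrence
    psi (z + 1) = psi z + 1 / z together with psi (z + n) - ln n --> 0 exhibits
    D as a limit of explicit rational sums, which gives its bound and its
    measurability at once. The asymptotics of psi come from the concentration
    of a Gamma(a + n)-distributed variable around n on the logarithmic scale. *)


(** Only a two-sided bound on [D] is established, so nothing excludes [phi t <= 0] for large [t].
    The proof is arranged to survive this: with the default values of [ln] and [powR], every
    derivative in the exponent vanishes at a base [<= 0], which leaves a weak sign everywhere; the
    strict sign is needed only near [t = 0], where [1 - phi <= C t^2] forces [phi > 0]. The bound on
    [D] has to stay below 2, because [1 + t^2] must beat [1 + t^2 D / 2]; the value 3 / 2 leaves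
    room. Digamma is reachable only through Euler's integral and its complex derivative. Writing
    [x^(ib)] through [y = ln x] turns the components of Gamma and of its derivative into integrals
    of [cos (b y)], [sin (b y)], [y cos (b y)], [y sin (b y)] against one real kernel, so a single
    integration by parts gives both functional equations. That Gamma has no zero, needed to divide,
    comes from the same concentration: it holds far to the right and descends through
    [Gamma (z + 1) = z Gamma z]. *)

(** * Improper integrals on the open half-line *)

Section half_line.
Context {R : realType}.
Let mu := @lebesgue_measure R.
Implicit Types (f F : R -> R) (a b x C l : R).
(** The right end is [n + 2] so that already [A 0 = [1, 2]] is nondegenerate, as the fundamental
    theorem on a segment requires. *)
Let A n : set R := `[n.+1%:R^-1, n.+2%:R]%classic.

Lemma continuous_gt0_measurable f :
  (forall x, 0 < x -> {for x, continuous f}) -> measurable_fun (`]0, +oo[%classic : set R) f.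
Proof.
move=> cf; apply: open_continuous_measurable_fun => //.
by apply/in_setP => x; rewrite /= in_itv/= andbT => /cf.
Qed.

Lemma integral_segment_gt0 f F a b : 0 < a -> a < b ->
  (forall x, 0 < x -> {for x, continuous f}) ->
  (forall x, 0 < x -> is_derive x 1 F (f x)) ->
  (\int[mu]_(x in `[a, b]) (f x)%:E = (F b - F a)%:E)%E.
Proof.
move=> a0 ab cf dF; rewrite EFinB; apply: continuous_FTC2 => //.
- apply: continuous_in_subspaceT => x; rewrite inE /= in_itv/= => /andP[ax _].
  by apply: cf; exact: lt_le_trans ax.
- have cF x : 0 < x -> {for x, continuous F}.
    move=> x0; apply: differentiable_continuous.
    by apply/derivable1_diffP; have [] := dF x x0.
  split.
  + move=> x; rewrite in_itv/= => /andP[ax _].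
    by have [] := dF x (lt_trans a0 ax).
  + by apply: cvg_at_right_filter; exact: cF.
  + by apply: cvg_at_left_filter; apply: cF; exact: lt_trans ab.
- move=> x; rewrite in_itv/= => /andP[ax _].
  by rewrite derive1E; have [_ ->] := dF x (lt_trans a0 ax).
Qed.

Let half_line_exhaustion : `]0, +oo[%classic = \bigcup_n A n :> set R.
Proof.
apply/seteqP; split => [x|x [n _]]; rewrite /A /= !in_itv/= ?andbT; last first.
  by move=> /andP[+ _]; apply: lt_le_trans; rewrite invr_gt0.
move=> x0; have [n1 xn1] : exists n : nat, x <= n%:R.
  by exists (Num.truncn x).+1; exact/ltW/truncnS_gt.
have [n2 xn2] : exists n : nat, x^-1 <= n%:R.
  by exists (Num.truncn x^-1).+1; exact/ltW/truncnS_gt.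
exists (n1 + n2)%N => //; rewrite /A /= in_itv/=; apply/andP; split.
  rewrite -[leRHS]invrK lef_pV2 ?posrE ?invr_gt0//.
  by apply: le_trans xn2 _; rewrite ler_nat; lia.
by apply: le_trans xn1 _; rewrite ler_nat; lia.
Qed.

Let segment_seq_sub i :
  A i `<=` (`]0, +oo[%classic : set R).
Proof.
move=> x; rewrite /A /= !in_itv/= andbT => /andP[+ _].
by apply: lt_le_trans; rewrite invr_gt0.
Qed.

Let segment_seq_nd :
  nondecreasing_seq A.
Proof.
move=> m n mn; apply/subsetPset => x; rewrite /A /= !in_itv/= => /andP[h1 h2].
apply/andP; split.
  by apply: le_trans h1; rewrite lef_pV2 ?posrE// ler_nat.
by apply: le_trans h2 _; rewrite ler_nat.
Qed.

(** A nonnegative function with a bounded primitive: its integrals over the segments [A n] increase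
    to the full integral and stay below [C + C]. No limit of [F] at either end is needed. *)
Lemma half_line_integrable f F C :
  (forall x, 0 < x -> {for x, continuous f}) ->
  (forall x, 0 < x -> 0 <= f x) ->
  (forall x, 0 < x -> is_derive x 1 F (f x)) ->
  (forall x, 0 < x -> `|F x| <= C) ->
  mu.-integrable (`]0, +oo[%classic : set R) (EFin \o f).
Proof.
move=> cf f0 dF FC; have mf := continuous_gt0_measurable cf.
apply/integrableP; split; first exact/measurable_EFinP.
under eq_integral => x.
  rewrite inE /= in_itv/= andbT => x0.
  by rewrite /= ger0_norm ?f0//; over.
rewrite half_line_exhaustion.
have sub := segment_seq_sub.
have cvI : (\int[mu]_(x in A i) (f x)%:E @[i --> \oo] -->
    \int[mu]_(x in \bigcup_n A n) (f x)%:E)%E.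
  apply: ge0_nondecreasing_set_cvg_integral; first exact: segment_seq_nd.
  - by move=> i; exact: measurable_itv.
  - by move=> i; apply/measurable_EFinP; apply: measurable_funS mf => //; exact: sub.
  - by move=> i x /sub /=; rewrite in_itv/= andbT lee_fin; exact: f0.
apply: (@le_lt_trans _ _ (C + C)%:E); last exact: ltry.
rewrite -(cvg_lim _ cvI)//; apply: lime_le.
  by apply/cvg_ex; eexists; exact: cvI.
apply: nearW => n /=; rewrite (@integral_segment_gt0 f F) ?invr_gt0//; last first.
  apply: (@le_lt_trans _ _ 1); last by rewrite ltr1n.
  by rewrite invf_le1// ler1n.
rewrite lee_fin (le_trans (ler_norm _))// (le_trans (ler_normB _ _))//.
by apply: lerD; apply: FC; rewrite ?invr_gt0.
Qed.

(** Integrability is assumed, so [f] may change sign: dominated convergence along [A n], with [|f|]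
    itself as majorant. *)
Lemma half_line_FTC2 f F l0 l1 :
  (forall x, 0 < x -> {for x, continuous f}) ->
  (forall x, 0 < x -> is_derive x 1 F (f x)) ->
  mu.-integrable (`]0, +oo[%classic : set R) (EFin \o f) ->
  F x @[x --> 0^'+] --> l0 -> F x @[x --> +oo] --> l1 ->
  \int[mu]_(x in `]0, +oo[) f x = l1 - l0.
Proof.
move=> cf dF intf F0 F1.
have mf := continuous_gt0_measurable cf.
have sub := segment_seq_sub.
have [] := @dominated_convergence _ _ _ mu `]0, +oo[%classic (measurable_itv _)
  (fun n => EFin \o (f \_ (A n))) (EFin \o f) (abse \o (EFin \o f)).
- move=> n; apply/measurable_EFinP/measurable_restrict => //.
    exact: measurable_itv.
  by apply: measurable_funS mf => // x [].
- exact/measurable_EFinP.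
- apply: aeW => x; rewrite half_line_exhaustion => -[N _ AN] /=.
  have NA n : (N <= n)%N -> A N `<=` A n by move=> /segment_seq_nd /subsetPset.
  apply: cvg_near_cst; near=> n.
  by rewrite patchE mem_set//; apply: NA AN; near: n; exists N.
- exact: integrable_abse.
- apply: aeW => x n _ /=; rewrite lee_fin patchE; case: ifP => // _.
  by rewrite normr0.
move=> _ _ /= cv.
have seqI n : (\int[mu]_(x in `]0%R, +oo[) (f \_ (A n) x)%:E =
               (F n.+2%:R - F n.+1%:R^-1)%:E)%E.
  rewrite -(@integral_segment_gt0 f F) ?invr_gt0//; last first.
    apply: (@le_lt_trans _ _ 1); last by rewrite ltr1n.
    by rewrite invf_le1// ler1n.
  rewrite [in RHS]integral_mkcond [in LHS]integral_mkcond; apply: eq_integral => x _.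
  rewrite !patchE; case: ifPn => // xI; case: ifPn => // xA.
  by case/negP: xI; move: xA; rewrite !inE => /sub.
have {}cv : F n.+2%:R - F n.+1%:R^-1 @[n --> \oo] --> \int[mu]_(x in `]0, +oo[) f x.
  suff /fine_cvg : ((F n.+2%:R - F n.+1%:R^-1)%:E @[n --> \oo] -->
     (\int[mu]_(x in `]0, +oo[) f x)%:E)%E by [].
  rewrite /Rintegral fineK; last exact: integrable_fin_num.
  by under eq_fun do rewrite -seqI; exact: cv.
apply: (cvg_unique _ cv) => //.
apply: cvgB.
  move/cvg_pinftyP: F1; apply.
  have -> : (fun n => n.+2%:R : R) = (fun n => n%:R) \o addn^~ 2%N.
    by apply/funext => n /=; rewrite addn2.
  apply: cvg_comp; [exact: cvg_addnr|exact: cvgr_idn].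
move/cvg_at_rightP : F0; apply; split; first by move=> n; rewrite invr_gt0.
exact: cvg_harmonic.
Unshelve. all: by end_near. Qed.
(** A zero integral would make [f] vanish almost everywhere, and then []0, e[] would lie in a null
    set. *)
Lemma half_line_Rintegral_gt0 f e : 0 < e ->
  mu.-integrable (`]0, +oo[%classic : set R) (EFin \o f) ->
  (forall x, 0 < x -> 0 <= f x) -> (forall x, 0 < x < e -> 0 < f x) ->
  0 < \int[mu]_(x in `]0, +oo[) f x.
Proof.
move=> e0 intf f0 fe; rewrite lt_neqAle; apply/andP; split; last first.
  by apply: Rintegral_ge0 => x /=; rewrite in_itv/= andbT; exact: f0.
apply/eqP => I0.
have : ae_eq mu (`]0, +oo[%classic : set R) (EFin \o f) (cst 0%E).
  apply/ae_eq_integral_abs => //; first exact: measurable_int intf.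
  transitivity (\int[mu]_(x in `]0%R, +oo[) (f x)%:E)%E; last first.
    rewrite -[LHS]fineK; last exact: integrable_fin_num.
    by rewrite -[fine _]/(\int[mu]_(x in `]0%R, +oo[) f x) -I0.
  apply: eq_integral => x; rewrite inE /= in_itv/= andbT => x0.
  by rewrite ger0_norm ?f0.
move=> [N [mN N0 sub]].
have : (mu `]0%R, e[%classic <= mu N)%E.
  apply: le_measure; rewrite ?inE// => x /=; rewrite in_itv/= => xe.
  apply: sub => /= /(_ _); rewrite in_itv/= andbT.
  have /andP[x0 _] := xe.
  by move=> /(_ x0) [] fx0; have := fe x xe; rewrite fx0 ltxx.
move=> /le_trans h.
have : (mu `]0%R, e[%classic <= 0)%E.
  by apply: h; rewrite le_eqVlt; apply/orP; left; apply/eqP; exact: N0.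
by rewrite /mu lebesgue_measure_itv/= lte_fin e0 sube0 leNgt lte_fin e0.
Qed.
End half_line.

(** * Elementary inequalities for exp, sin and cos *)

Section elementary_bounds.
Context {R : realType}.
Implicit Types (f df : R -> R) (u v x y c : R).

Lemma derive_ge0_le f df x : 0 <= x ->
  (forall y, is_derive y 1 f (df y)) ->
  (forall y, 0 < y -> 0 <= df y) -> f 0 <= f x.
Proof.
rewrite le_eqVlt => /predU1P[<-//|x0] dF df0.
have cF : {within `[0, x], continuous f}.
  apply: continuous_subspaceT => y; apply: differentiable_continuous.
  by apply/derivable1_diffP; have [] := dF y.
have [c] := MVT x0 (fun y _ => dF y) cF.
rewrite in_itv/= => /andP[c0 _] /eqP; rewrite subr_eq => /eqP ->.
by rewrite lerDr mulr_ge0 ?df0// subr0 ltW.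
Qed.

Lemma expR_sub1_le u : expR u - 1 <= u * expR u.
Proof.
have := ler_wpM2r (expR_ge0 u) (expR_ge1Dx (- u)).
by have := expRxMexpNx_1 u; lra.
Qed.

Lemma expR_taylor1 u : `|expR u - 1 - u| <= u ^+ 2 * expR `|u|.
Proof.
have h1 := expR_ge1Dx u; have h2 := expR_sub1_le u.
rewrite ger0_norm; last lra.
have e0 := expR_gt0 u.
have [u0|u0] := leP 0 u; first by rewrite ger0_norm//; nra.
have e1 : 1 <= expR `|u| by rewrite -[leLHS](expR0 R) ler_expR.
nra.
Qed.

(** [2 cosh u - 2 = (2 sinh (u / 2))^2], and [sinh v >= v] for [v >= 0] because its derivative
    [cosh] is at least 1. *)
Lemma expR_addN_ge u : 2 + u ^+ 2 <= expR u + expR (- u).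
Proof.
have half v : expR v = expR (v / 2) * expR (v / 2).
  by rewrite -expRD; congr expR; lra.
have sym v : 2 <= expR v + expR (- v).
  have h := expRxMexpNx_1 (v / 2).
  rewrite (half v) (half (- v)) mulNr.
  by have := sqr_ge0 (expR (v / 2) - expR (- (v / 2))); nra.
have sinh v : 0 <= v -> 2 * v <= expR v - expR (- v).
  move=> v0.
  pose f x : R := expR x - expR (- x) - 2 * x.
  have df y : is_derive y 1 f (expR y + expR (- y) - 2).
    by apply: is_derive_eq; rewrite /GRing.scale/=; lra.
  have h : f 0 <= f v.
    by apply: derive_ge0_le v0 df _ => y _; have := sym y; lra.
  by move: h; rewrite /f oppr0 mulr0 subr0 subrr; lra.
wlog u0 : u / 0 <= u.
  move=> H; have [/H//|u0] := leP 0 u.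
  have /H : 0 <= - u by lra.
  rewrite opprK sqrrN; lra.
have h := expRxMexpNx_1 (u / 2).
rewrite (half u) (half (- u)) mulNr.
by have := sinh (u / 2); nra.
Qed.

Lemma sqr_le_expR_addN d y : 0 < d ->
  y ^+ 2 <= d ^- 2 * (expR (d * y) + expR (- (d * y))).
Proof.
move=> d0; rewrite ler_pdivlMl ?exprn_gt0//.
by have := expR_addN_ge (d * y); rewrite exprMn; lra.
Qed.

Lemma sin_le v : 0 <= v -> sin v <= v.
Proof.
move=> v0.
pose f x : R := x - sin x.
have df y : is_derive y 1 f (1 - cos y) by apply: is_derive_eq.
have h : f 0 <= f v.
  by apply: derive_ge0_le v0 df _ => y _; have := cos_le1 y; lra.
by move: h; rewrite /f sin0; lra.
Qed.

Lemma normr_sin_le v : `|sin v| <= `|v|.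
Proof.
wlog v0 : v / 0 <= v.
  move=> H; have [/H//|v0] := leP 0 v.
  have /H : 0 <= - v by lra.
  by rewrite sinN !normrN.
rewrite (ger0_norm v0) ler_norml sin_le// andbT.
pose f x : R := x + sin x.
have df y : is_derive y 1 f (1 + cos y) by apply: is_derive_eq.
have h : f 0 <= f v.
  by apply: derive_ge0_le v0 df _ => y _; have := cos_geN1 y; lra.
by move: h; rewrite /f sin0; lra.
Qed.

Lemma one_sub_cos_le v : 1 - cos v <= v ^+ 2 / 2.
Proof.
have -> : v = (v / 2) *+ 2 by lra.
rewrite cos_mulr2n; have := cos2Dsin2 (v / 2).
have := normr_sin_le (v / 2); rewrite -ler_sqr ?nnegrE// !real_normK ?num_real//.
lra.
Qed.

Lemma normr_sin_sub_le v : `|sin v - v| <= v ^+ 2.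
Proof.
wlog v0 : v / 0 <= v.
  move=> H; have [/H//|v0] := leP 0 v.
  have /H : 0 <= - v by lra.
  by rewrite sinN sqrrN -normrN opprD !opprK.
have := sin_le v0; rewrite distrC => h0; rewrite ger0_norm; last lra.
pose f x : R := x ^+ 2 - x + sin x.
have df y : is_derive y 1 f (2 * y - 1 + cos y).
  by apply: is_derive_eq; rewrite /GRing.scale/=; lra.
have h : f 0 <= f v.
  apply: derive_ge0_le v0 df _ => y y0.
  (* [1 - cos y] is at most both [y^2 / 2] and 2, and the smaller of these is at most [2 y]. *)
  have := one_sub_cos_le y; have := cos_geN1 y; nra.
by move: h; rewrite /f sin0 expr0n/=; lra.
Qed.

(** Real part of [|e^w - 1 - w| = O(|w|^2 e^|u|)] for [w = u + iv]; [expR_sin_taylor] is the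
    imaginary part. The bound does not grow exponentially in [v]. *)
Lemma expR_cos_taylor u v :
  `|expR u * cos v - 1 - u| <= 2 * (u ^+ 2 + v ^+ 2) * expR `|u|.
Proof.
have -> : expR u * cos v - 1 - u =
  (expR u - 1 - u) * cos v - (1 + u) * (1 - cos v) by ring.
apply: (le_trans (ler_normB _ _)); rewrite !normrM.
have h1 := expR_taylor1 u; have h2 := cos_max v.
have h3 : `|1 + u| <= expR `|u|.
  apply: (le_trans (ler_normD _ _)); rewrite normr1; exact: expR_ge1Dx.
have h4 : `|1 - cos v| <= v ^+ 2 / 2.
  by rewrite ger0_norm ?one_sub_cos_le// subr_ge0 cos_le1.
have h5 := ler_pM (normr_ge0 _) (normr_ge0 _) h1 h2.
have h6 := ler_pM (normr_ge0 _) (normr_ge0 _) h3 h4.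
have e0 := expR_ge0 `|u|; have u2 := sqr_ge0 u; have v2 := sqr_ge0 v.
have := mulr_ge0 u2 e0; have := mulr_ge0 v2 e0; lra.
Qed.

Lemma expR_sin_taylor u v :
  `|expR u * sin v - v| <= 2 * (u ^+ 2 + v ^+ 2) * expR `|u|.
Proof.
have -> : expR u * sin v - v = expR u * (sin v - v) + (expR u - 1) * v by ring.
apply: (le_trans (ler_normD _ _)); rewrite !normrM (ger0_norm (expR_ge0 u)).
have h0 : expR u <= expR `|u| by rewrite ler_expR ler_norm.
have h1 : `|expR u - 1| <= `|u| * expR `|u|.
  have k1 := expR_sub1_le u; have k2 := expR_ge1Dx u; have k3 := expR_gt0 u.
  have [u0|u0] := leP 0 u.
    by rewrite !ger0_norm//; lra.
  have : 1 <= expR `|u| by rewrite -[leLHS](expR0 R) ler_expR.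
  rewrite (ltr0_norm u0) => *; rewrite ler_norml; nra.
have h2 := normr_sin_sub_le v.
have h3 := ler_pM (expR_ge0 _) (normr_ge0 _) h0 h2.
have h4 := ler_wpM2r (normr_ge0 v) h1.
have h5 : `|u| * `|v| <= (u ^+ 2 + v ^+ 2) / 2.
  rewrite -(real_normK (num_real u)) -(real_normK (num_real v)).
  by have := sqr_ge0 (`|u| - `|v|); lra.
have e0 := expR_ge0 `|u|; have u2 := sqr_ge0 u; have v2 := sqr_ge0 v.
have h6 := ler_wpM2r e0 h5.
have := mulr_ge0 u2 e0; have := mulr_ge0 v2 e0; lra.
Qed.

(** Evaluate [1 - cos v <= v^2 / 2] at [v = pi / 2]. *)
Lemma pi_sqr_ge8 : 8 <= pi ^+ 2 :> R.
Proof. by have := one_sub_cos_le (pi / 2); rewrite cos_pihalf; lra. Qed.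

End elementary_bounds.

(** * Integrals against the Gamma kernel *)

Section gamma_integral.
Context {R : realType}.
Let mu := @lebesgue_measure R.
Implicit Types (q r dq : R -> R) (a b c d s t x y : R).

Let mI : measurable (`]0%R, +oo[%classic : set R).
Proof. exact: measurable_itv. Qed.

(** With [y = ln x], the bound reads [|q (ln x)| <= C max(x, 1/x)^d], which the kernel
    [x^(a-1) e^(-x)] absorbs at both ends as soon as [d < a]. *)
Definition exp_growth d q :=
  continuous q /\ exists C, forall y, `|q y| <= C * expR (d * `|y|).

Lemma exp_growth_le d d' q : d <= d' -> exp_growth d q -> exp_growth d' q.
Proof.
move=> dd' [cq [C qC]]; split => //; exists C => y; apply: (le_trans (qC y)).
have C0 : 0 <= C.
  have := le_trans (normr_ge0 _) (qC y).
  by rewrite pmulr_lge0// expR_gt0.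
by rewrite ler_wpM2l// ler_expR ler_wpM2r.
Qed.

Lemma exp_growthD d q r : exp_growth d q -> exp_growth d r ->
  exp_growth d (fun y => q y + r y).
Proof.
move=> [cq [C qC]] [cr [D rD]]; split.
  by move=> y; apply: cvgD; [exact: cq|exact: cr].
exists (C + D) => y; rewrite mulrDl (le_trans (ler_normD _ _))//.
by apply: lerD.
Qed.

Lemma exp_growthM d e q r : exp_growth d q -> exp_growth e r ->
  exp_growth (d + e) (fun y => q y * r y).
Proof.
move=> [cq [C qC]] [cr [D rD]]; split.
  by move=> y; apply: cvgM; [exact: cq|exact: cr].
exists (C * D) => y; rewrite mulrDl expRD mulrACA normrM.
exact: ler_pM.
Qed.

Lemma exp_growth_cst c : exp_growth 0 (fun=> c).
Proof.
split; first by move=> y; exact: cvg_cst.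
by exists `|c| => y; rewrite mul0r expR0 mulr1.
Qed.

Lemma exp_growthZ d c q : exp_growth d q -> exp_growth d (fun y => c * q y).
Proof. by move/(exp_growthM (exp_growth_cst c)); rewrite add0r. Qed.

Lemma exp_growth_cos b : exp_growth 0 (fun y => cos (b * y)).
Proof.
split.
  by move=> y; apply: continuous_comp;
    [exact: mulrl_continuous|exact: continuous_cos].
by exists 1 => y; rewrite mul0r expR0 mulr1 cos_max.
Qed.

Lemma exp_growth_sin b : exp_growth 0 (fun y => sin (b * y)).
Proof.
split.
  by move=> y; apply: continuous_comp;
    [exact: mulrl_continuous|exact: continuous_sin].
by exists 1 => y; rewrite mul0r expR0 mulr1 sin_max.
Qed.

Lemma exp_growth_id d : 0 < d -> exp_growth d id.
Proof.
move=> d0; split; first by move=> y; exact: cvg_id.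
exists d^-1 => y.
rewrite -[leLHS](mulKf (lt0r_neq0 d0)) ler_wpM2l ?invr_ge0 ?(ltW d0)//.
by have := expR_ge1Dx (d * `|y|); lra.
Qed.

Lemma exp_growth_norm d q : exp_growth d q -> exp_growth d (fun y => `|q y|).
Proof.
move=> [cq [C qC]]; split; last by exists C => y; rewrite normr_id.
by move=> y; apply: cvg_norm; exact: cq.
Qed.

Lemma exp_growth_expR s : exp_growth `|s| (fun y => expR (s * y)).
Proof.
split.
  by move=> y; apply: continuous_comp;
    [exact: mulrl_continuous|exact: continuous_expR].
exists 1 => y; rewrite mul1r ger0_norm ?expR_ge0// ler_expR -normrM.
exact: ler_norm.
Qed.

Definition gamma_ker a x := expR (- x) * expR ((a - 1) * ln x).

(** Up to the factor [Gamma a], the expectation of [q (ln X)] for [X] with the Gamma(a)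
    distribution. *)
Definition gamma_int a q := \int[mu]_(x in `]0, +oo[) (gamma_ker a x * q (ln x)).

Lemma gamma_ker_ge0 a x : 0 <= gamma_ker a x.
Proof. by rewrite mulr_ge0 ?expR_ge0. Qed.

Lemma continuous_gamma_ker a x : 0 < x -> {for x, continuous (gamma_ker a)}.
Proof.
move=> x0; apply: cvgM.
  by apply: continuous_comp; [exact: oppr_continuous|exact: continuous_expR].
apply: (@continuous_comp _ _ _ (fun x => (a - 1) * ln x) expR); last exact: continuous_expR.
by apply: cvgM; [exact: cvg_cst|exact: continuous_ln].
Qed.

Lemma continuous_gamma_ker_comp a q x : continuous q -> 0 < x ->
  {for x, continuous (fun x => gamma_ker a x * q (ln x))}.
Proof.
move=> cq x0; apply: cvgM; first exact: continuous_gamma_ker.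
by apply: continuous_comp; [exact: continuous_ln|exact: cq].
Qed.

(** The concave function [c ln] lies below its tangent at [c / e], where the slope is [e]. *)
Lemma ln_le_linear c e x : 0 < c -> 0 < e -> 0 < x -> c * ln x <= e * x + c * (ln (c / e) - 1).
Proof.
move=> c0 e0 x0.
have -> : ln x = ln (c / e) + ln (x * e / c).
  rewrite -lnM ?posrE ?divr_gt0 ?mulr_gt0//; congr ln; field.
  by rewrite !gt_eqF.
have h : ln (x * e / c) <= x * e / c - 1.
  have := @le_ln1Dx _ (x * e / c - 1).
  rewrite [1 + _]addrC subrK; apply.
  have : 0 < x * e / c by rewrite divr_gt0 ?mulr_gt0.
  lra.
have := ler_wpM2l (ltW c0) h.
have -> : c * (x * e / c - 1) = e * x - c by field; rewrite gt_eqF.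
by lra.
Qed.

(* The function (x / (1 + x)) ^ a is bounded, and its derivative
   a x ^ (a - 1) / (1 + x) ^ (a + 1) dominates the kernel. *)
Lemma integrable_gamma_ker a : 0 < a ->
  mu.-integrable (`]0, +oo[%classic : set R) (EFin \o gamma_ker a).
Proof.
move=> a0.
pose F x : R := expR (a * (ln x - ln (1 + x))).
pose f x : R := F x * (a / (x * (1 + x))).
have dF x : 0 < x -> is_derive x 1 F (f x).
  move=> x0.
  have x1 : 0 < 1 + x by lra.
  have dln : is_derive x 1 (fun x => ln (1 + x)) (1 + x)^-1.
    have dl := is_derive1_ln x1.
    by apply: is_derive_eq; rewrite /GRing.scale/= add0r mulr1.
  have dl := is_derive1_ln x0.
  rewrite /F; apply: is_derive_eq.
  rewrite /f /F /GRing.scale/=; field.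
  by rewrite !gt_eqF.
have intf : mu.-integrable (`]0, +oo[%classic : set R) (EFin \o f).
  apply: (@half_line_integrable _ f F 1) => // x x0.
  - have x1 : 0 < 1 + x by lra.
    apply: cvgM.
      apply: differentiable_continuous.
      by apply/derivable1_diffP; have [] := dF x x0.
    apply: cvgM; first exact: cvg_cst.
    apply: cvgV; first by rewrite mulf_neq0// gt_eqF.
    by apply: cvgM; [exact: cvg_id|apply: cvgD; [exact: cvg_cst|exact: cvg_id]].
  - have x1 : 0 < 1 + x by lra.
    by rewrite mulr_ge0 ?expR_ge0// divr_ge0 ?mulr_ge0// ltW.
  - rewrite ger0_norm ?expR_ge0// -[leRHS](expR0 R) ler_expR.
    rewrite pmulr_rle0// subr_le0 ler_ln ?posrE//; lra.
(* [K] comes from [ln_le_linear] at [1 + x] with slope 1, which bounds [e^(-x)] by a constant times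
   [(1 + x)^(-(a + 1))]; the division by [a] removes the factor [a] of [f]. *)
pose K : R := expR (1 + (a + 1) * (ln ((a + 1) / 1) - 1)) / a.
apply: (@le_integrable _ _ _ mu _ mI _ (fun x => (K%:E * (EFin \o f) x)%E)).
- apply/measurable_EFinP; apply: continuous_gt0_measurable => x; exact: continuous_gamma_ker.
- move=> x /=; rewrite in_itv/= andbT => x0.
  have x1 : 0 < 1 + x by lra.
  rewrite lee_fin ger0_norm ?gamma_ker_ge0//.
  apply: le_trans (ler_norm _).
  have -> : K * f x = expR (1 + (a + 1) * (ln ((a + 1) / 1) - 1)) *
      expR (a * (ln x - ln (1 + x))) *
      (expR (- ln x) * expR (- ln (1 + x))).
    rewrite /K /f /F !expRN !lnK ?posrE//; field.
    by rewrite !gt_eqF.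
  rewrite /gamma_ker -!expRD ler_expR.
  have a1 : 0 < a + 1 by lra.
  by have := ln_le_linear a1 ltr01 x1; lra.
- exact: (@integrableZl _ _ _ mu _ mI K).
Qed.

Lemma expR_normr_le y : expR `|y| <= expR y + expR (- y).
Proof.
have [y0|y0] := leP 0 y; rewrite ?(ger0_norm y0) ?(ltr0_norm y0).
  by rewrite lerDl expR_ge0.
by rewrite lerDr expR_ge0.
Qed.

Lemma gamma_ker_shift a s x : gamma_ker (a + s) x = gamma_ker a x * expR (s * ln x).
Proof. by rewrite /gamma_ker -!expRD; congr expR; ring. Qed.

(** [e^(d |ln x|) <= x^d + x^(-d)], so the kernels of parameters [a + d] and [a - d], both positive,
    dominate. *)
Lemma integrable_gamma_ker_comp a d q : 0 <= d -> d < a -> exp_growth d q ->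
  mu.-integrable (`]0, +oo[%classic : set R)
    (EFin \o (fun x => gamma_ker a x * q (ln x))).
Proof.
move=> d0 da [cq [C qC]].
pose g x := ((EFin \o gamma_ker (a + d)) x + (EFin \o gamma_ker (a - d)) x)%E.
have intg : mu.-integrable (`]0, +oo[%classic : set R) g.
  by apply: (@integrableD _ _ _ mu _ mI); apply: integrable_gamma_ker; lra.
apply: (@le_integrable _ _ _ mu _ mI _ (fun x => (C%:E * g x)%E)).
- apply/measurable_EFinP; apply: continuous_gt0_measurable => x.
  exact: continuous_gamma_ker_comp.
- move=> x /=; rewrite in_itv/= andbT => x0.
  rewrite /g /= lee_fin normrM (ger0_norm (gamma_ker_ge0 _ _)).
  apply: le_trans (ler_norm _).
  rewrite !gamma_ker_shift mulNr -mulrDr mulrCA ler_wpM2l ?gamma_ker_ge0//.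
  apply: (le_trans (qC _)).
  have C0 : 0 <= C.
    have := le_trans (normr_ge0 _) (qC 0).
    by rewrite pmulr_lge0// expR_gt0.
  rewrite ler_wpM2l// -[X in X * `|_|](ger0_norm d0) -normrM.
  exact: expR_normr_le.
- exact: (@integrableZl _ _ _ mu _ mI C).
Qed.

Lemma gamma_intD a d q r : 0 <= d -> d < a -> exp_growth d q -> exp_growth d r ->
  gamma_int a (fun y => q y + r y) = gamma_int a q + gamma_int a r.
Proof.
move=> d0 da gq gr; rewrite /gamma_int -RintegralD//; last 2 first.
- exact: integrable_gamma_ker_comp gq.
- exact: integrable_gamma_ker_comp gr.
by apply: eq_Rintegral => x _; rewrite mulrDr.
Qed.

Lemma gamma_intZ a d c q : 0 <= d -> d < a -> exp_growth d q ->
  gamma_int a (fun y => c * q y) = c * gamma_int a q.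
Proof.
move=> d0 da gq; rewrite /gamma_int -RintegralZl//; last exact: integrable_gamma_ker_comp gq.
by apply: eq_Rintegral => x _; rewrite mulrCA.
Qed.

Lemma le_gamma_int a d q r : 0 <= d -> d < a -> exp_growth d q -> exp_growth d r ->
  (forall y, q y <= r y) -> gamma_int a q <= gamma_int a r.
Proof.
move=> d0 da gq gr qr; apply: le_Rintegral => //.
- exact: integrable_gamma_ker_comp gq.
- exact: integrable_gamma_ker_comp gr.
- by move=> x _; rewrite ler_wpM2l ?gamma_ker_ge0.
Qed.

Lemma normr_gamma_int_le a d q r : 0 <= d -> d < a -> exp_growth d q -> exp_growth d r ->
  (forall y, `|q y| <= r y) -> `|gamma_int a q| <= gamma_int a r.
Proof.
move=> d0 da gq gr qr; rewrite ler_norml; apply/andP; split.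
  rewrite lerNl -mulN1r -(gamma_intZ _ d0 da gq).
  apply: (le_gamma_int d0 da) => //; first exact: exp_growthZ.
  by move=> y; rewrite mulN1r (le_trans _ (qr y))// -normrN ler_norm.
by apply: (le_gamma_int d0 da) => // y; rewrite (le_trans (ler_norm _)).
Qed.

(** Brings integrals at different real parts under one kernel, where they can be compared
    pointwise. *)
Lemma gamma_int_shift a s q :
  gamma_int (a + s) q = gamma_int a (fun y => expR (s * y) * q y).
Proof. by apply: eq_Rintegral => x _; rewrite gamma_ker_shift mulrA. Qed.

Lemma gamma_int1_gt0 a : 0 < a -> 0 < gamma_int a (fun=> 1).
Proof.
move=> a0; apply: (@half_line_Rintegral_gt0 _ _ 1) => //.
- exact: (integrable_gamma_ker_comp (lexx 0) a0 (exp_growth_cst 1)).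
- by move=> x _; rewrite mulr1 gamma_ker_ge0.
- by move=> x _; rewrite mulr1 mulr_gt0 ?expR_gt0.
Qed.

Lemma expR_mul_ln_cvg0 c : 0 < c -> expR (c * ln x) @[x --> 0^'+] --> 0.
Proof.
move=> c0; apply: cvg_trans (powR_cvg0 c0); apply: near_eq_cvg; near=> x.
by rewrite /powR gt_eqF.
Unshelve. all: by end_near. Qed.

Lemma expRN_mul_expR_ln_cvg0 c : 0 < c ->
  expR (- x) * expR (c * ln x) @[x --> +oo] --> 0.
Proof.
move=> c0; pose K := expR (c * (ln (c / 2^-1) - 1)).
apply: (@squeeze_cvgr _ _ _ _ (cst 0) (fun x => K * expR (- (2^-1 * x)))).
- near=> x; have x0 : 0 < x by [].
  rewrite mulr_ge0 ?expR_ge0//= /K -!expRD ler_expR.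
  have h2 : 0 < 2^-1 :> R by lra.
  by have := ln_le_linear c0 h2 x0; lra.
- exact: cvg_cst.
- suff : K * expR (- (2^-1 * x)) @[x --> +oo] --> K * 0 by rewrite mulr0.
  apply: cvgMr.
  apply: (cvg_comp (fun x => 2^-1 * x) (fun x => expR (- x))); last exact: cvgr_expR.
  by apply: gt0_cvgMry; [lra|exact: cvg_id].
Unshelve. all: by end_near. Qed.

(** Integration by parts: the derivative of [F x = e^(-x) x^a q (ln x)] has integral zero, since [F]
    vanishes at 0 (because [d < a]) and at infinity. *)
Lemma gamma_int_rec a d q dq : 0 <= d -> d < a -> exp_growth d q -> exp_growth d dq ->
  (forall y, is_derive y 1 q (dq y)) ->
  gamma_int (a + 1) q = a * gamma_int a q + gamma_int a dq.
Proof.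
move=> d0 da gq gdq Dq.
have gaq := exp_growthZ a gq.
have gs := exp_growthD gaq gdq.
pose F x : R := expR (- x) * expR (a * ln x) * q (ln x).
pose f x : R := gamma_ker a x * (a * q (ln x) + dq (ln x)) - gamma_ker (a + 1) x * q (ln x).
have int1 := integrable_gamma_ker_comp d0 da gs.
have int2 : mu.-integrable (`]0, +oo[%classic : set R)
    (EFin \o (fun x => gamma_ker (a + 1) x * q (ln x))).
  by apply: integrable_gamma_ker_comp gq => //; lra.
have dF x : 0 < x -> is_derive x 1 F (f x).
  move=> x0; have dl := is_derive1_ln x0.
  have dql : is_derive x 1 (fun x => q (ln x)) (dq (ln x) * x^-1).
    exact: (@is_derive1_comp _ q (@ln R) x (dq (ln x)) x^-1).
  rewrite /F; apply: is_derive_eq.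
  rewrite /f gamma_ker_shift mul1r lnK ?posrE//.
  rewrite /gamma_ker mulrBl mul1r expRB lnK ?posrE// /GRing.scale/=.
  by field; rewrite gt_eqF.
have [cq [C qC]] := gq.
have C0 : 0 <= C.
  have := le_trans (normr_ge0 _) (qC 0).
  by rewrite pmulr_lge0// expR_gt0.
have FC x : 0 < x -> `|F x| <= C * (expR (- x) * (expR ((a + d) * ln x) + expR ((a - d) * ln x))).
  move=> x0; rewrite /F normrM ger0_norm; last by rewrite mulr_ge0 ?expR_ge0.
  rewrite [leRHS](_ : _ = expR (- x) * expR (a * ln x) *
      (C * (expR (d * ln x) + expR (- (d * ln x))))); last first.
    by rewrite !mulrDl mulNr !expRD; ring.
  rewrite ler_wpM2l ?mulr_ge0 ?expR_ge0//.
  apply: (le_trans (qC _)); rewrite ler_wpM2l//.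
  by rewrite -[X in X * `|_|](ger0_norm d0) -normrM expR_normr_le.
have F0 : F x @[x --> 0^'+] --> (0 : R).
  apply: norm_cvg0; apply: (@squeeze_cvgr _ _ _ _ (cst 0)
     (fun x => C * (1 * (expR ((a + d) * ln x) + expR ((a - d) * ln x))))).
  - near=> x; have x0 : 0 < x by [].
    rewrite normr_ge0/= (le_trans (FC _ x0))// ler_wpM2l//.
    have e1 : expR (- x) <= 1 by rewrite -[leRHS](expR0 R) ler_expR; lra.
    by apply: ler_wpM2r e1; rewrite addr_ge0 ?expR_ge0.
  - exact: cvg_cst.
  - suff : C * (1 * (expR ((a + d) * ln x) + expR ((a - d) * ln x))) @[x --> 0^'+] -->
        C * (1 * (0 + 0)) by rewrite addr0 !mulr0.
    by do 2 apply: cvgMr; apply: cvgD; apply: expR_mul_ln_cvg0; lra.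
have F1 : F x @[x --> +oo] --> (0 : R).
  apply: norm_cvg0; apply: (@squeeze_cvgr _ _ _ _ (cst 0)
     (fun x => C * (expR (- x) * expR ((a + d) * ln x) + expR (- x) * expR ((a - d) * ln x)))).
  - near=> x; have x0 : 0 < x by [].
    by rewrite normr_ge0/= -mulrDr; exact: FC.
  - exact: cvg_cst.
  - suff : C * (expR (- x) * expR ((a + d) * ln x) + expR (- x) * expR ((a - d) * ln x))
        @[x --> +oo] --> C * (0 + 0) by rewrite addr0 !mulr0.
    apply: cvgMr.
    by apply: cvgD; apply: expRN_mul_expR_ln_cvg0; lra.
have cf x : 0 < x -> {for x, continuous f}.
  move=> x0; have [cs _] := gs.
  apply: cvgB; last exact: (continuous_gamma_ker_comp cq x0).
  exact: (continuous_gamma_ker_comp cs x0).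
have intf : mu.-integrable (`]0, +oo[%classic : set R) (EFin \o f).
  exact: (@integrableB _ _ _ mu _ mI _ _ int1 int2).
have := half_line_FTC2 cf dF intf F0 F1.
rewrite subrr /f RintegralB// => /subr0_eq h.
by rewrite -(gamma_intZ _ d0 da gq) -(gamma_intD d0 da gaq gdq) /gamma_int h.
Unshelve. all: by end_near. Qed.

End gamma_integral.

(** * Complex derivative and functional equations of Gamma *)

Section complex_gamma.
Context {R : realType}.
Local Open Scope complex_scope.
Implicit Types (a b s t y : R) (z : R[i]).

(** Euler's integral with an extra factor [ln x]: the result of formally differentiating [x^(z-1)]
    under the integral sign. *)
Definition dGamma z : R[i] :=
  gamma_int (complex.Re z) (fun y => y * cos (complex.Im z * y)) +i*
  gamma_int (complex.Re z) (fun y => y * sin (complex.Im z * y)).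

Lemma Gamma_gamma_int z : Gamma z =
  gamma_int (complex.Re z) (fun y => cos (complex.Im z * y)) +i*
  gamma_int (complex.Re z) (fun y => sin (complex.Im z * y)).
Proof.
case: z => a b; rewrite /Gamma /gamma_int /gamma_ker /=.
by congr (_ +i* _); apply: eq_Rintegral => x _ /=;
  rewrite /cpowR /= !(mul0r, subr0, addr0, mulr0, add0r, oppr0) ?mulrA.
Qed.

Lemma complex_norm_le (z : R[i]) : `|z| <= (`|complex.Re z| + `|complex.Im z|)%:C.
Proof.
case: z => a b /=; rewrite normc_def /= lecR.
rewrite -[leRHS]ger0_norm ?addr_ge0// -sqrtr_sqr ler_wsqrtr//.
rewrite -(real_normK (num_real a)) -(real_normK (num_real b)).
by have := mulr_ge0 (normr_ge0 a) (normr_ge0 b); nra.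
Qed.

Let major a y : R := expR (a * y) + expR (- a * y).

Let exp_growth_major a d : 0 <= a -> a <= d -> exp_growth d (major a).
Proof.
move=> a0 ad; apply: exp_growthD.
  by apply: exp_growth_le (exp_growth_expR a); rewrite ger0_norm.
by apply: exp_growth_le (exp_growth_expR (- a)); rewrite normrN ger0_norm.
Qed.

(** Both [y^2] (up to [d^-2]) and [e^|s y|] are at most [2 cosh (d y)]; the product is handled by
    [(p + q)^2 <= 2 (p^2 + q^2)], which doubles the rate to [2 d]. *)
Let taylor_major d s t y : 0 < d -> `|s| <= d ->
  2 * ((s * y) ^+ 2 + (t * y) ^+ 2) * expR `|s * y| <=
  (s ^+ 2 + t ^+ 2) * (4 * d ^- 2 * major (2 * d) y).
Proof.
move=> d0 sd.
rewrite !exprMn -mulrDl [leRHS](_ : _ =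
  2 * (s ^+ 2 + t ^+ 2) * (2 * d ^- 2 * major (2 * d) y)); last by ring.
rewrite mulrA -mulrA ler_wpM2l//; first by have := sqr_ge0 s; have := sqr_ge0 t; lra.
set p := expR (d * y); set q := expR (- (d * y)).
have h1 : y ^+ 2 <= d ^- 2 * (p + q) by exact: sqr_le_expR_addN.
have h2 : expR `|s * y| <= p + q.
  apply: le_trans (expR_normr_le (d * y)); rewrite ler_expR !normrM.
  by rewrite ler_wpM2r// (le_trans sd)// ler_norm.
have := ler_pM (sqr_ge0 y) (expR_ge0 _) h1 h2.
move/le_trans; apply.
rewrite -!mulrA [leRHS](_ : _ = d ^- 2 * (2 * major (2 * d) y)); last by ring.
rewrite ler_wpM2l//; first by rewrite invr_ge0 exprn_ge0// ltW.
have -> : major (2 * d) y = p ^+ 2 + q ^+ 2.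
  by rewrite /major !expr2 -!expRD; congr (expR _ + expR _); ring.
by have := sqr_ge0 (p - q); nra.
Qed.

(* Componentwise, the remainder is the integral of x^(z-1) (x^h - 1 - h ln x). *)
Lemma Gamma_taylor1 a : 0 < a -> exists2 K : R, 0 <= K &
  exists2 d : R, 0 < d & forall b s t, `|s| <= d ->
  `|Gamma ((a + s) +i* (b + t)) - Gamma (a +i* b) - (s +i* t) * dGamma (a +i* b)| <=
  (K * (s ^+ 2 + t ^+ 2))%:C.
Proof.
(* The majorant has rate [2 d = a / 2 < a]. Only [s] must be small, as [x^(it)] has modulus 1. *)
move=> a0; pose d := a / 4; have d0 : 0 < d by rewrite /d; lra.
have da : 2 * d < a by rewrite /d; lra.
have d20 : 0 <= 2 * d by lra.
pose M y := 4 * d ^- 2 * major (2 * d) y.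
have gM : exp_growth (2 * d) M by apply: exp_growthZ; apply: exp_growth_major.
exists (4 * gamma_int a M).
  rewrite mulr_ge0//; apply: Rintegral_ge0 => x _.
  rewrite mulr_ge0 ?gamma_ker_ge0// mulr_ge0 ?addr_ge0 ?expR_ge0//.
  by rewrite mulr_ge0// invr_ge0 exprn_ge0// ltW.
exists d => // b s t sd.
have g0 q : exp_growth 0 q -> exp_growth (2 * d) q by apply: exp_growth_le.
have gs q : exp_growth 0 q -> exp_growth (2 * d) (fun y => expR (s * y) * q y).
  move=> gq; apply: (@exp_growth_le _ (`|s| + 0)); first by lra.
  exact: exp_growthM (exp_growth_expR s) gq.
have gy q : exp_growth 0 q -> exp_growth (2 * d) (fun y => y * q y).
  move=> gq; apply: (@exp_growth_le _ (2 * d + 0)); first by lra.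
  by apply: exp_growthM gq; apply: exp_growth_id; lra.
(* [q1] and [q2] will be [cos (b y)] and [sin (b y)] up to order and sign; being bounded by 1, they
   make the constant independent of [b]. *)
have rem_le (q1 q2 : R -> R) y : `|q1 y| <= 1 -> `|q2 y| <= 1 ->
   `|q1 y * (expR (s * y) * cos (t * y) - 1 - s * y) +
     q2 y * (expR (s * y) * sin (t * y) - t * y)|
   <= 2 * ((s ^+ 2 + t ^+ 2) * M y).
  move=> h1 h2; apply: (le_trans (ler_normD _ _)); rewrite !normrM.
  have k1 := expR_cos_taylor (s * y) (t * y).
  have k2 := expR_sin_taylor (s * y) (t * y).
  have k3 := @taylor_major d s t y d0 sd.
  have k4 := ler_pM (normr_ge0 _) (normr_ge0 _) h1 k1.
  have k5 := ler_pM (normr_ge0 _) (normr_ge0 _) h2 k2.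
  rewrite /M; lra.
pose c y := cos (b * y); pose n y := sin (b * y).
have gc : exp_growth 0 c := exp_growth_cos b.
have gn : exp_growth 0 n := exp_growth_sin b.
have gct := exp_growth_cos (b + t).
have gnt := exp_growth_sin (b + t).
have lin (q0 q1 q2 q3 : R -> R) k1 k2 :
   exp_growth (2 * d) q0 -> exp_growth (2 * d) q1 -> exp_growth (2 * d) q2 -> exp_growth (2 * d) q3 ->
   gamma_int a q0 - gamma_int a q1 - (k1 * gamma_int a q2 + k2 * gamma_int a q3) =
   gamma_int a (fun y => q0 y + (-1 * q1 y + (- k1 * q2 y + - k2 * q3 y)))
   /\ exp_growth (2 * d) (fun y => q0 y + (-1 * q1 y + (- k1 * q2 y + - k2 * q3 y))).
  move=> G0 G1 G2 G3.
  have H3 := exp_growthZ (- k2) G3; have H2 := exp_growthZ (- k1) G2.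
  have H1 := exp_growthZ (-1) G1.
  have H23 := exp_growthD H2 H3; have H123 := exp_growthD H1 H23.
  split; last exact: exp_growthD.
  rewrite (gamma_intD d20 da G0 H123) (gamma_intD d20 da H1 H23) (gamma_intD d20 da H2 H3).
  by rewrite !(gamma_intZ _ d20 da)//; ring.
have bnd (q : R -> R) : exp_growth (2 * d) q -> (forall y, `|q y| <= 2 * ((s ^+ 2 + t ^+ 2) * M y)) ->
    `|gamma_int a q| <= 2 * (s ^+ 2 + t ^+ 2) * gamma_int a M.
  move=> gq qM; rewrite -(gamma_intZ _ d20 da gM).
  apply: (normr_gamma_int_le d20 da gq (exp_growthZ _ gM)) => y.
  by rewrite -mulrA.
have [e1 G1] := lin _ _ _ _ s (- t) (gs _ gct) (g0 _ gc) (gy _ gc) (gy _ gn).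
have [e2 G2] := lin _ _ _ _ s t (gs _ gnt) (g0 _ gn) (gy _ gn) (gy _ gc).
have B1 := bnd _ G1; have B2 := bnd _ G2.
apply: (le_trans (complex_norm_le _)); rewrite lecR.
rewrite !Gamma_gamma_int /dGamma /= !gamma_int_shift.
move: e1 e2; rewrite /c /n mulNr => -> ->.
have -> : 4 * gamma_int a M * (s ^+ 2 + t ^+ 2) =
  2 * (s ^+ 2 + t ^+ 2) * gamma_int a M + 2 * (s ^+ 2 + t ^+ 2) * gamma_int a M by ring.
apply: lerD; [apply: B1|apply: B2] => y.
- apply: le_trans (@rem_le c (fun y => - n y) y _ _); rewrite ?normrN ?cos_max ?sin_max//.
  by rewrite mulrDl cosD le_eqVlt; apply/orP; left; apply/eqP; congr `|_|; rewrite /c /n; ring.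
- apply: le_trans (@rem_le n c y _ _); rewrite ?cos_max ?sin_max//.
  by rewrite mulrDl sinD le_eqVlt; apply/orP; left; apply/eqP; congr `|_|; rewrite /c /n; ring.
Qed.

Lemma derive1_Gamma z : 0 < complex.Re z ->
  derive1 (@Gamma R : R[i] -> R[i]^o) z = dGamma z.
Proof.
case: z => a b /= a0; have [K K0 [d d0 tay]] := Gamma_taylor1 a0.
apply/cvg_lim => //.
apply/cvgrPdist_le => /= e e0.
(* In the order of [R[i]], [0 < e] forces [e] to be real. *)
have er : e = (complex.Re e)%:C.
  by move: e0; case: e => e1 e2; rewrite ltcE => /andP[/eqP /= -> _].
have re0 : 0 < complex.Re e by rewrite er ltcR in e0.
(* The remainder divided by [|h|] is at most [K |h|]; [K + 1] avoids dividing by zero when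
   [K = 0]. *)
pose r := Num.min d (complex.Re e / (K + 1)).
have r0 : 0 < r by rewrite lt_min d0 divr_gt0//; lra.
near=> h.
have h0 : h != 0 by near: h; exact: (@nbhs_dnbhs_neq R[i]^o).
have hr : `|h| <= r%:C.
  by near: h; apply: (@dnbhs0_le _ R[i]^o); rewrite ltcR.
rewrite [_ *: _]/(_ * _).
have nh : `|h| = (Num.sqrt (complex.Re h ^+ 2 + complex.Im h ^+ 2))%:C.
  by case: (h) => u v; rewrite normc_def.
set rho := Num.sqrt _ in nh.
have rho0 : 0 <= rho by exact: sqrtr_ge0.
have rhop : 0 < rho by rewrite -ltcR -nh normr_gt0.
have rho2 : rho ^+ 2 = complex.Re h ^+ 2 + complex.Im h ^+ 2.
  by rewrite sqr_sqrtr// addr_ge0// sqr_ge0.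
have rhor : rho <= r by rewrite -lecR -nh.
have sd : `|complex.Re h| <= d.
  apply: (@le_trans _ _ rho); last by apply: (le_trans rhor); rewrite ge_min lexx.
  by rewrite -ler_sqr ?nnegrE// real_normK ?num_real// rho2 lerDl sqr_ge0.
have := tay b _ (complex.Im h) sd.
rewrite -rho2.
have -> : (a + complex.Re h) +i* (b + complex.Im h) = h + (a +i* b).
  by case: (h) => u v /=; rewrite addrC [b + v]addrC.
have -> : complex.Re h +i* complex.Im h = h by case: (h).
move=> T.
rewrite -(ler_pM2l (_ : 0 < `|h|)) ?normr_gt0// -normrM.
have -> : h * (dGamma (a +i* b) - h^-1 * (Gamma (h + (a +i* b)) - Gamma (a +i* b))) =
  - (Gamma (h + (a +i* b)) - Gamma (a +i* b) - h * dGamma (a +i* b)).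
  by rewrite mulrBr mulVKf// [RHS]opprB.
rewrite normrN (le_trans T)// nh er -rmorphM lecR expr2 mulrA [leRHS]mulrC ler_wpM2r//.
apply: (@le_trans _ _ ((K + 1) * r)); first by apply: ler_pM; lra.
by rewrite mulrC -ler_pdivlMr ?ge_min ?lexx ?orbT//; lra.
Unshelve. all: by end_near. Qed.

Lemma GammaD1 z : 0 < complex.Re z -> Gamma (z + 1) = z * Gamma z.
Proof.
case: z => a b /= a0; rewrite !Gamma_gamma_int /= addr0.
have D1 y : is_derive y 1 (fun y => cos (b * y)) (- b * sin (b * y)).
  by apply: is_derive_eq; rewrite /GRing.scale/=; ring.
have D2 y : is_derive y 1 (fun y => sin (b * y)) (b * cos (b * y)).
  by apply: is_derive_eq; rewrite /GRing.scale/=; ring.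
have gc := exp_growth_cos b; have gs := exp_growth_sin b.
rewrite (gamma_int_rec (lexx 0) a0 gc (exp_growthZ _ gs) D1).
rewrite (gamma_int_rec (lexx 0) a0 gs (exp_growthZ _ gc) D2).
rewrite (gamma_intZ _ (lexx 0) a0 gc) (gamma_intZ _ (lexx 0) a0 gs).
by congr (_ +i* _); ring.
Qed.

(** The derivative of [Gamma (z + 1) = z Gamma z], obtained by integrating [y cos (b y)] and
    [y sin (b y)] by parts rather than by differentiating. *)
Lemma dGammaD1 z : 0 < complex.Re z -> dGamma (z + 1) = Gamma z + z * dGamma z.
Proof.
case: z => a b /= a0; rewrite Gamma_gamma_int /dGamma /= addr0.
have D1 y : is_derive y 1 (fun y => y * cos (b * y)) (cos (b * y) + - b * (y * sin (b * y))).
  by apply: is_derive_eq; rewrite /GRing.scale/=; ring.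
have D2 y : is_derive y 1 (fun y => y * sin (b * y)) (sin (b * y) + b * (y * cos (b * y))).
  by apply: is_derive_eq; rewrite /GRing.scale/=; ring.
have a20 : 0 <= a / 2 by lra.
have a2a : a / 2 < a by lra.
have gc := exp_growth_le a20 (exp_growth_cos b).
have gs := exp_growth_le a20 (exp_growth_sin b).
have gid : exp_growth (a / 2) id by apply: exp_growth_id; lra.
have gyc : exp_growth (a / 2) (fun y => y * cos (b * y)).
  by rewrite -[a / 2]addr0; apply: exp_growthM gid (exp_growth_cos b).
have gys : exp_growth (a / 2) (fun y => y * sin (b * y)).
  by rewrite -[a / 2]addr0; apply: exp_growthM gid (exp_growth_sin b).
have gyc' := exp_growthZ b gyc; have gys' := exp_growthZ (- b) gys.
rewrite (gamma_int_rec a20 a2a gyc (exp_growthD gc gys') D1).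
rewrite (gamma_int_rec a20 a2a gys (exp_growthD gs gyc') D2).
rewrite (gamma_intD a20 a2a gc gys') (gamma_intD a20 a2a gs gyc').
rewrite (gamma_intZ _ a20 a2a gyc) (gamma_intZ _ a20 a2a gys).
by congr (_ +i* _); ring.
Qed.

End complex_gamma.

(** * Concentration of the Gamma law and asymptotics of digamma *)

Section digamma_asymptotics.
Context {R : realType}.
Local Open Scope complex_scope.
Implicit Types (a b c d e y : R) (z : R[i]).

(* If X has the Gamma(a) distribution, then E[X / x] and E[x / X] are a / x and
   x / (a - 1), and cosh u - 1 >= u ^ 2 / 2 turns this into a bound on the
   mean of |ln (X / x)|. *)
Let mean_abs_log_le a d x : 1 < a -> 0 < d -> 0 < x ->
  gamma_int a (fun y => `|y - ln x|) <=
  (d / 2 + (a / x + x / (a - 1) - 2) / (2 * d)) * gamma_int a (fun=> 1).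
Proof.
move=> a1 d0 x0.
pose p y := expR (1 * y) * 1; pose q y := expR (-1 * y) * 1.
(* The midpoint of 1 and [a]: [e^y] and [e^(-y)] grow at rate 1, and the rate must stay below
   [a]. *)
set h := (1 + a) / 2.
have h0 : 0 <= h by rewrite /h; lra.
have ha : h < a by rewrite /h; lra.
have gc : exp_growth h (fun=> 1 : R) by apply: exp_growth_le h0 (exp_growth_cst 1).
have gp : exp_growth h p.
  apply: (@exp_growth_le _ (`|1| + 0)).
    by rewrite normr1 /h; lra.
  exact: exp_growthM (exp_growth_expR 1) (exp_growth_cst 1).
have gq : exp_growth h q.
  apply: (@exp_growth_le _ (`|-1| + 0)).
    by rewrite normrN1 /h; lra.
  exact: exp_growthM (exp_growth_expR (-1)) (exp_growth_cst 1).
have gl : exp_growth h (fun y => `|y - ln x|).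
  apply: exp_growth_norm; apply: exp_growthD; first by apply: exp_growth_id; rewrite /h; lra.
  exact: exp_growth_le h0 (exp_growth_cst _).
have g1 := exp_growthZ (d / 2 - d^-1) gc.
have g2 := exp_growthZ (x^-1 / (2 * d)) gp.
have g3 := exp_growthZ (x / (2 * d)) gq.
have g23 := exp_growthD g2 g3.
have g123 := exp_growthD g1 g23.
have D1 y : is_derive y 1 (fun=> 1 : R) (0 : R) by exact: is_derive_cst.
have Ep : gamma_int a p = a * gamma_int a (fun=> 1).
  rewrite /p -gamma_int_shift (gamma_int_rec (lexx 0) _ (exp_growth_cst 1) (exp_growth_cst 0) D1); last lra.
  have -> : (fun=> 0 : R) = (fun y : R => 0 * (1 : R)) by apply/funext => y; rewrite mul0r.
  by rewrite (gamma_intZ _ h0 ha gc) mul0r addr0.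
have Eq : gamma_int a q = (a - 1)^-1 * gamma_int a (fun=> 1).
  have e : a = (a - 1) + 1 by lra.
  rewrite /q -gamma_int_shift [in RHS]e.
  have a0 : 0 < a - 1 by lra.
  rewrite (gamma_int_rec (lexx 0) a0 (exp_growth_cst 1) (exp_growth_cst 0) D1).
  have -> : (fun=> 0 : R) = (fun y : R => 0 * (1 : R)) by apply/funext => y; rewrite mul0r.
  rewrite (gamma_intZ _ (lexx 0) a0 (exp_growth_cst 1)) mul0r addr0 addrK.
  by rewrite mulKf// gt_eqF.
have -> : (d / 2 + (a / x + x / (a - 1) - 2) / (2 * d)) * gamma_int a (fun=> 1) =
  gamma_int a (fun y => (d / 2 - d^-1) * 1 + (x^-1 / (2 * d) * p y + x / (2 * d) * q y)).
  rewrite (gamma_intD h0 ha g1 g23) (gamma_intD h0 ha g2 g3).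
  rewrite (gamma_intZ _ h0 ha gc) (gamma_intZ _ h0 ha gp) (gamma_intZ _ h0 ha gq) Ep Eq.
  field; rewrite !gt_eqF//; lra.
apply: (le_gamma_int h0 ha gl g123) => y.
have -> : x^-1 / (2 * d) * p y + x / (2 * d) * q y =
   (expR (y - ln x) + expR (- (y - ln x))) / (2 * d).
  rewrite /p /q opprB !expRB lnK ?posrE// mul1r mulN1r expRN; field.
  by rewrite !gt_eqF ?expR_gt0.
have h1 := expR_addN_ge (y - ln x).
(* Arithmetic-geometric mean with a free weight [d], to be chosen as the target precision. *)
have h2 : `|y - ln x| <= d / 2 + (y - ln x) ^+ 2 / (2 * d).
  rewrite -(real_normK (num_real (y - ln x))).
  rewrite -subr_ge0 [leRHS](_ : _ = (`|y - ln x| - d) ^+ 2 / (2 * d)).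
    by rewrite divr_ge0 ?sqr_ge0//; lra.
  by field; rewrite gt_eqF.
apply: (le_trans h2).
have : 0 <= (2 * d)^-1 by rewrite invr_ge0; lra.
move=> /ler_wpM2r /(_ _ _ h1).
have -> : (2 + (y - ln x) ^+ 2) / (2 * d) = d^-1 + (y - ln x) ^+ 2 / (2 * d).
  by field; rewrite gt_eqF.
lra.
Qed.

(** Take [x = n] and [d = e] in the previous bound. The bracket is at most [(3 a + 2) / n], hence at
    most [e^2] for large [n], and the total is [e / 2 + e / 2]. *)
Let mean_abs_log_small a e : 0 < a -> 0 < e -> exists N, forall n, (N <= n)%N ->
  [/\ (0 < n)%N, 1 < a + n%:R &
  gamma_int (a + n%:R) (fun y => `|y - ln n%:R|) <= e * gamma_int (a + n%:R) (fun=> 1)].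
Proof.
move=> a0 e0; have [N hN] : exists N : nat, (3 * a + 2) / e ^+ 2 <= N%:R.
  by eexists; exact/ltW/truncnS_gt.
exists N.+2 => n Nn; have n2 : (2 : R) <= n%:R by rewrite ler_nat; lia.
have n0 : (0 : R) < n%:R by lra.
split; [lia|lra|].
have an : 1 < a + n%:R by lra.
apply: (le_trans (mean_abs_log_le an e0 n0)).
apply: ler_wpM2r; first by apply/ltW/gamma_int1_gt0; lra.
suff : (a + n%:R) / n%:R + n%:R / (a + n%:R - 1) - 2 <= e ^+ 2.
  move=> H; have : 0 <= (2 * e)^-1 by rewrite invr_ge0; lra.
  move=> /ler_wpM2r /(_ _ _ H).
  have -> : e ^+ 2 / (2 * e) = e / 2 by field; rewrite gt_eqF.
  lra.
have -> : (a + n%:R) / n%:R + n%:R / (a + n%:R - 1) - 2 =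
  a / n%:R + (1 - a) / (a + n%:R - 1) by field; rewrite !gt_eqF//; lra.
apply: (@le_trans _ _ ((3 * a + 2) / n%:R)).
  have : (1 - a) / (a + n%:R - 1) <= (2 * a + 2) / n%:R.
    rewrite ler_pdivrMr; last lra.
    rewrite mulrAC ler_pdivlMr//; nra.
  have -> : (3 * a + 2) / n%:R = a / n%:R + (2 * a + 2) / n%:R by field; rewrite gt_eqF.
  lra.
rewrite ler_pdivrMr// -ler_pdivrMl ?exprn_gt0// mulrC (le_trans hN)// ler_nat; lia.
Qed.

Let normr_cos_sub y y' : `|cos y - cos y'| <= `|y - y'|.
Proof.
have -> : cos y - cos y' = - 2 * sin ((y + y') / 2) * sin ((y - y') / 2).
  have e1 : y = (y + y') / 2 + (y - y') / 2 by lra.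
  have e2 : y' = (y + y') / 2 - (y - y') / 2 by lra.
  transitivity (cos ((y + y') / 2 + (y - y') / 2) - cos ((y + y') / 2 - (y - y') / 2)).
    by rewrite -e1 -e2.
  by rewrite cosD cosB; ring.
rewrite !normrM normrN [`|2|]ger0_norm//.
have h1 := sin_max ((y + y') / 2); have h2 := normr_sin_le ((y - y') / 2).
have h3 := ler_pM (normr_ge0 _) (normr_ge0 _) h1 h2.
have n2 : `|(y - y') / 2| = `|y - y'| / 2 by rewrite normrM [`|2^-1|]ger0_norm.
rewrite n2 in h3; lra.
Qed.

Let normr_sin_sub y y' : `|sin y - sin y'| <= `|y - y'|.
Proof.
have -> : sin y - sin y' = 2 * cos ((y + y') / 2) * sin ((y - y') / 2).
  have e1 : y = (y + y') / 2 + (y - y') / 2 by lra.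
  have e2 : y' = (y + y') / 2 - (y - y') / 2 by lra.
  transitivity (sin ((y + y') / 2 + (y - y') / 2) - sin ((y + y') / 2 - (y - y') / 2)).
    by rewrite -e1 -e2.
  by rewrite sinD sinB; ring.
rewrite !normrM [`|2|]ger0_norm//.
have h1 := cos_max ((y + y') / 2); have h2 := normr_sin_le ((y - y') / 2).
have h3 := ler_pM (normr_ge0 _) (normr_ge0 _) h1 h2.
have n2 : `|(y - y') / 2| = `|y - y'| / 2 by rewrite normrM [`|2^-1|]ger0_norm.
rewrite n2 in h3; lra.
Qed.

(** When [ln X] is close to [ln n] in mean, [ln X] may be replaced by [ln n] in [dGamma], and
    [X^(ib)] by the unimodular [n^(ib)] in Gamma. The quotient of the two estimates controls
    digamma. *)
Let Gamma_approx a b n e : (0 < n)%N -> 1 < a + n%:R ->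
  gamma_int (a + n%:R) (fun y => `|y - ln n%:R|) <= e * gamma_int (a + n%:R) (fun=> 1) ->
  `|dGamma ((a + n%:R) +i* b) - (ln n%:R)%:C * Gamma ((a + n%:R) +i* b)| <=
    (2 * (e * gamma_int (a + n%:R) (fun=> 1)))%:C /\
  ((1 - 2 * `|b| * e) * gamma_int (a + n%:R) (fun=> 1))%:C <= `|Gamma ((a + n%:R) +i* b)|.
Proof.
set A := a + n%:R; set L := ln n%:R; set W := gamma_int A (fun=> 1) => n0 A1 EW.
have h0 : (0 : R) <= 2^-1 by lra.
have hA : 2^-1 < A by lra.
have W0 : 0 < W by apply: gamma_int1_gt0; lra.
have g1 : exp_growth 2^-1 (fun=> 1 : R) := exp_growth_le h0 (exp_growth_cst 1).
have gL : exp_growth 2^-1 (fun y => y - L).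
  apply: exp_growthD; first by apply: exp_growth_id; lra.
  exact: exp_growth_le h0 (exp_growth_cst _).
have gaL := exp_growth_norm gL.
have gc := exp_growth_le h0 (exp_growth_cos b).
have gs := exp_growth_le h0 (exp_growth_sin b).
have gy q : exp_growth 0 q -> exp_growth 2^-1 (fun y => y * q y).
  move=> gq; rewrite -[2^-1]addr0; apply: exp_growthM gq; apply: exp_growth_id; lra.
have mono k q : exp_growth 2^-1 q -> (forall y, `|q y| <= k * `|y - L|) -> 0 <= k ->
    `|gamma_int A q| <= k * (e * W).
  move=> gq qk k0; apply: (@le_trans _ _ (k * gamma_int A (fun y => `|y - L|))).
    by rewrite -(gamma_intZ _ h0 hA gaL); apply: (normr_gamma_int_le h0 hA gq (exp_growthZ _ gaL)).
  by rewrite ler_wpM2l.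
have sub q : exp_growth 0 q -> (forall y, `|q y| <= 1) ->
    `|gamma_int A (fun y => y * q y) - L * gamma_int A q| <= e * W.
  move=> gq q1; have gq' := exp_growth_le h0 gq.
  rewrite -mulNr -(gamma_intZ _ h0 hA gq').
  rewrite -(gamma_intD h0 hA (gy _ gq) (exp_growthZ _ gq')) -[leRHS]mul1r.
  apply: mono => //; first exact: exp_growthD (gy _ gq) (exp_growthZ _ gq').
  move=> y; rewrite -mulrDl normrM mulrC; apply: ler_wpM2r => //.
split.
  apply: (le_trans (complex_norm_le _)); rewrite lecR Gamma_gamma_int /dGamma /=.
  rewrite !(mul0r, subr0, addr0).
  have := sub _ (exp_growth_cos b) (fun y => cos_max (b * y)).
  have := sub _ (exp_growth_sin b) (fun y => sin_max (b * y)).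
  lra.
have b0 := normr_ge0 b.
have C1 : `|gamma_int A (fun y => cos (b * y)) - cos (b * L) * W| <= `|b| * (e * W).
  have gk := exp_growthZ (- cos (b * L)) g1.
  rewrite -mulNr -(gamma_intZ _ h0 hA g1) -(gamma_intD h0 hA gc gk).
  apply: mono => //; first exact: exp_growthD gc gk.
  by move=> y; rewrite mulr1 (le_trans (normr_cos_sub _ _))// -mulrBr normrM.
have S1 : `|gamma_int A (fun y => sin (b * y)) - sin (b * L) * W| <= `|b| * (e * W).
  have gk := exp_growthZ (- sin (b * L)) g1.
  rewrite -mulNr -(gamma_intZ _ h0 hA g1) -(gamma_intD h0 hA gs gk).
  apply: mono => //; first exact: exp_growthD gs gk.
  by move=> y; rewrite mulr1 (le_trans (normr_sin_sub _ _))// -mulrBr normrM.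
(* [w = n^(ib) Gamma (a + n)], of modulus [W]. *)
pose w : R[i] := (cos (b * L) * W) +i* (sin (b * L) * W).
have nw : `|w| = W%:C.
  rewrite normc_def /= !exprMn -mulrDl cos2Dsin2 mul1r sqrtr_sqr ger0_norm//.
  exact: ltW.
have : `|Gamma (A +i* b) - w| <= (2 * (`|b| * (e * W)))%:C.
  apply: (le_trans (complex_norm_le _)); rewrite lecR Gamma_gamma_int /=.
  by have := lerD C1 S1; lra.
move=> H; have := ler_normB (Gamma (A +i* b)) (Gamma (A +i* b) - w).
rewrite opprB addrC subrK nw => H2.
have -> : (1 - 2 * `|b| * e) * W = W - 2 * (`|b| * (e * W)) by ring.
rewrite rmorphB /= lerBlDr (le_trans H2)// lerD2l//.
Qed.

Lemma digammaE z : 0 < complex.Re z -> digamma z = dGamma z / Gamma z.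
Proof. by move=> z0; rewrite /digamma derive1_Gamma. Qed.

Lemma digamma_ln z e : 0 < complex.Re z -> 0 < e -> exists N, forall n, (N <= n)%N ->
  Gamma (z + n%:R) != 0 /\ `|digamma (z + n%:R) - (ln n%:R)%:C| <= e%:C.
Proof.
case: z => a b /= a0 e0.
have b0 := normr_ge0 b.
have be0 := mulr_ge0 b0 (ltW e0).
(* The solution of [2 d = e (1 - 2 |b| d)], which equates the two bounds of [Gamma_approx] up to the
   factor [e]. *)
pose d := e / (2 + 2 * `|b| * e).
have D0 : 0 < 2 + 2 * `|b| * e by nra.
have d0 : 0 < d by rewrite divr_gt0.
have [N hN] := mean_abs_log_small a0 d0.
exists N => n /hN[n0 an EW].
have [] := Gamma_approx b n0 an EW.
set W := gamma_int _ (fun=> 1).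
have W0 : 0 < W by apply: gamma_int1_gt0; lra.
have -> : (a +i* b) + n%:R = (a + n%:R) +i* b :> R[i].
  by rewrite -(rmorph_nat (real_complex R)) /=; simpc.
set G := Gamma _; set dG := dGamma _ => H1 H2.
have c0 : 0 < 1 - 2 * `|b| * d.
  have -> : 1 - 2 * `|b| * d = 2 / (2 + 2 * `|b| * e).
    by rewrite /d; field; rewrite gt_eqF.
  by rewrite divr_gt0.
have G0 : 0 < `|G| by apply: lt_le_trans H2; rewrite ltcR mulr_gt0.
split; first by rewrite -normr_gt0.
have Gn0 : G != 0 by rewrite -normr_gt0.
rewrite digammaE /=; last lra.
rewrite -/G -/dG.
have -> : dG / G - (ln n%:R)%:C = (dG - (ln n%:R)%:C * G) / G.
  by rewrite mulrBl mulfK.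
rewrite normf_div ler_pdivrMr//; apply: (le_trans H1).
apply: (@le_trans _ _ (e%:C * ((1 - 2 * `|b| * d) * W)%:C)); last first.
  by rewrite ler_wpM2l// lecR ltW.
rewrite -rmorphM lecR [leLHS]mulrA [leRHS]mulrA; apply: ler_wpM2r; first exact: ltW.
by rewrite /d le_eqVlt; apply/orP; left; apply/eqP; field; rewrite gt_eqF.
Qed.

(** [digamma_ln] gives a nonzero value at some [z + N]; a zero at [z] would propagate there through
    [GammaD1]. *)
Lemma Gamma_neq0 z : 0 < complex.Re z -> Gamma z != 0.
Proof.
move=> z0; have [N /(_ N (leqnn N)) [+ _]] := digamma_ln z0 ltr01.
elim: N => [|n IH] in z z0 *; first by rewrite addr0.
have zn : 0 < complex.Re (z + n%:R).
  case: z z0 => a b /= a0; rewrite -(rmorph_nat (real_complex R)) /=.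
  by rewrite ltr_wpDr// ler0n.
by rewrite -natr1 addrA GammaD1// mulf_eq0 negb_or => /andP[_ /IH]; exact.
Qed.

Lemma digammaD1 z : 0 < complex.Re z -> digamma (z + 1) = digamma z + z^-1.
Proof.
move=> z0.
have z10 : 0 < complex.Re (z + 1) by case: z z0 => a b /= a0; lra.
have zn0 : z != 0 by apply: contraTneq z0 => ->; rewrite ltxx.
rewrite !digammaE// dGammaD1// GammaD1//; field.
by rewrite zn0 Gamma_neq0.
Qed.

End digamma_asymptotics.

(** * The difference of digamma values as a series *)

Section digamma_difference.
Context {R : realType}.
Local Open Scope complex_scope.
Implicit Types (a b c d e y : R) (z : R[i]).

Lemma digammaDn z n : 0 < complex.Re z ->
  digamma (z + n%:R) = digamma z + \sum_(k < n) (z + k%:R)^-1.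
Proof.
move=> z0; elim: n => [|n IH]; first by rewrite big_ord0 !addr0.
have zn : 0 < complex.Re (z + n%:R).
  case: z z0 {IH} => a b /= a0; rewrite -(rmorph_nat (real_complex R)) /=.
  by rewrite ltr_wpDr// ler0n.
by rewrite -natr1 addrA digammaD1// IH big_ord_recr/= addrA.
Qed.

(** The real part of [1 / (1/2 + k + ib) - 1 / (1 + k + ib)]. *)
Let term b k : R := (2^-1 + k%:R) / ((2^-1 + k%:R) ^+ 2 + b ^+ 2) -
                    (1 + k%:R) / ((1 + k%:R) ^+ 2 + b ^+ 2).

Let diff b : R := complex.Re (digamma (1 +i* b) - digamma (2^-1 +i* b)).

Let close_sub (e l s t u v : R) : `|u + s - l| <= e / 2 -> `|v + t - l| <= e / 2 ->
  `|u - v - (t - s)| <= e.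
Proof. by rewrite !ler_norml; lra. Qed.

(** Both shifted digammas are within [e / 2] of the same [ln n], which cancels in the difference. *)
Lemma digamma_diff_series b : \sum_(k < n) term b k @[n --> \oo] --> diff b.
Proof.
apply/cvgrPdist_le => e e0.
have z1 : 0 < complex.Re (1 +i* b) by rewrite /=.
have z2 : 0 < complex.Re (2^-1 +i* b) by rewrite /= invr_gt0.
have e20 : 0 < e / 2 by lra.
have [N1 H1] := digamma_ln z1 e20.
have [N2 H2] := digamma_ln z2 e20.
exists (maxn N1 N2) => // n /=; rewrite geq_max => /andP[/H1[_ +] /H2[_ +]].
rewrite !digammaDn//.
have ReD (x y : R[i]) : complex.Re (x + y) = complex.Re x + complex.Re y by case: x y => ? ? [].
have ReN (x : R[i]) : complex.Re (- x) = - complex.Re x by case: x.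
have Re_le (x : R[i]) r : `|x| <= r%:C -> `|complex.Re x| <= r.
  case: x => u v; rewrite normc_def lecR /=; apply: le_trans.
  by rewrite -sqrtr_sqr ler_wsqrtr// lerDl sqr_ge0.
have Resum (z : R[i]) : complex.Re (\sum_(k < n) (z + k%:R)^-1) =
    \sum_(k < n) complex.Re (z + k%:R)^-1.
  elim: n => [|n IH]; first by rewrite !big_ord0.
  by rewrite !big_ord_recr/= ReD IH.
move=> /Re_le + /Re_le; rewrite !(ReD, ReN, Resum) /=.
rewrite /diff ReD ReN.
have -> : \sum_(k < n) term b k =
   \sum_(k < n) complex.Re (2^-1 +i* b + k%:R)^-1 - \sum_(k < n) complex.Re (1 +i* b + k%:R)^-1.
  rewrite -sumrB; apply: eq_bigr => k _.
  rewrite -(rmorph_nat (real_complex R)) /=.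
  by rewrite !addr0.
exact: close_sub.
Qed.

(** The right side is the term at [b = 0], namely [1 / (2 c d)]. It dominates because
    [|c d - b^2| <= c d + b^2] and [(c^2 + b^2) (d^2 + b^2) = (c d + b^2)^2 + b^2 (c - d)^2]. *)
Lemma term_bound b k : `|term b k| <= ((2 * k%:R + 1) * (k%:R + 1))^-1.
Proof.
rewrite /term; set K : R := k%:R; have K0 : 0 <= K by rewrite ler0n.
have [c1 c2] : 0 < 2^-1 + K /\ 0 < 1 + K by split; lra.
set c := 2^-1 + K in c1 *; set d := 1 + K in c2 *.
have b0 := sqr_ge0 b.
have p1 : 0 < c ^+ 2 + b ^+ 2 by nra.
have p2 : 0 < d ^+ 2 + b ^+ 2 by nra.
have cd : d = c + 2^-1 by rewrite /c /d; lra.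
have -> : c / (c ^+ 2 + b ^+ 2) - d / (d ^+ 2 + b ^+ 2) =
  (c * d - b ^+ 2) / (2 * ((c ^+ 2 + b ^+ 2) * (d ^+ 2 + b ^+ 2))).
  have -> : c * d - b ^+ 2 = 2 * (c * (d ^+ 2 + b ^+ 2) - d * (c ^+ 2 + b ^+ 2)).
    by rewrite cd; field.
  by field; rewrite !gt_eqF.
have -> : ((2 * K + 1) * (K + 1))^-1 = (2 * (c * d))^-1.
  by congr (_^-1); rewrite /c /d; field.
have cd0 : 0 < c * d by rewrite mulr_gt0.
have p3 : 0 < 2 * ((c ^+ 2 + b ^+ 2) * (d ^+ 2 + b ^+ 2)) by rewrite !mulr_gt0.
rewrite normf_div [X in _ / X]gtr0_norm// ler_pdivrMr// ler_pdivlMl; last by lra.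
apply: (@le_trans _ _ (2 * (c * d) * (c * d + b ^+ 2))).
  by rewrite ler_wpM2l//; [lra|rewrite ler_norml; nra].
rewrite -mulrA ler_wpM2l//.
have := sqr_ge0 (b * (c - d)).
nra.
Qed.

(** The term [k = 0] contributes 1. For [k >= 1], [(2 k + 1) (k + 1) >= 2 k (k + 1)] telescopes to
    at most 1 / 2. *)
Lemma sum_term_bound b n : `|\sum_(k < n) term b k| <= 3 / 2.
Proof.
apply: (le_trans (ler_norm_sum _ _ _)).
apply: (@le_trans _ _ (\sum_(k < n) ((2 * k%:R + 1) * (k%:R + 1))^-1)).
  by apply: ler_sum => k _; exact: term_bound.
case: n => [|n]; first by rewrite big_ord0; lra.
apply: (@le_trans _ _ (3 / 2 - (2 * n.+1%:R)^-1)).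
  elim: n => [|n IH].
    by rewrite big_ord1 /= mulr0 !add0r !mulr1 invr1; lra.
  rewrite big_ord_recr/=.
  have n0 : (0 : R) <= n%:R by rewrite ler0n.
  apply: (le_trans (lerD IH (lexx _))).
  rewrite -[n.+2%:R]natr1 -[n.+1%:R]natr1.
  suff : ((2 * (n%:R + 1) + 1) * (n%:R + 1 + 1))^-1 <= (2 * (n%:R + 1))^-1 - (2 * (n%:R + 1 + 1))^-1 :> R by lra.
  have -> : (2 * (n%:R + 1))^-1 - (2 * (n%:R + 1 + 1))^-1 = (2 * (n%:R + 1) * (n%:R + 1 + 1))^-1 :> R.
    by field; rewrite !gt_eqF//; lra.
  by rewrite lef_pV2 ?posrE; nra.
by rewrite lerBlDr lerDl invr_ge0.
Qed.

Lemma digamma_diff_bound b : `|diff b| <= 3 / 2.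
Proof.
have h : `|\sum_(k < n) term b k| @[n --> \oo] --> `|diff b|.
  by apply: cvg_norm; exact: digamma_diff_series.
rewrite -(cvg_lim _ h)//; apply: limr_le; first by apply/cvg_ex; eexists; exact: h.
by apply: nearW => n; exact: sum_term_bound.
Qed.

Lemma measurable_digamma_diff : measurable_fun setT diff.
Proof.
apply: (measurable_fun_cvg (h := fun n b => \sum_(k < n) term b k)); last first.
  by move=> b _; exact: digamma_diff_series.
move=> n; apply: measurable_sum => k; apply: continuous_measurable_fun => b.
have h c : 0 < c -> {for b, continuous (fun b => c / (c ^+ 2 + b ^+ 2))}.
  move=> c0; apply: cvgM; first exact: cvg_cst.
  apply: cvgV; first by rewrite gt_eqF// ltr_wpDr ?sqr_ge0// exprn_gt0.
  by apply: cvgD; [exact: cvg_cst|exact: exprn_continuous].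
have k0 : (0 : R) <= k%:R by rewrite ler0n.
by apply: cvgB; apply: h; lra.
Qed.

End digamma_difference.

(** * Differentiation in the exponent under the integral *)

Section power_integral.
Context {R : realType}.
Let mu := @lebesgue_measure R.
Implicit Types (c d l p t x : R) (k n : nat).

Let mI : measurable (`]0%R, +oo[%classic : set R).
Proof. exact: measurable_itv. Qed.

(* The [k]-th derivative of [1 - p `^ l] in [l]; for [p <= 0] the conventions
   [ln p = 0] and [0 `^ l = 0] make it vanish for [0 < k]. *)
Definition powR_defect k l p : R := (k == 0%N)%:R - ln p ^+ k * p `^ l.

Lemma is_derive_powR_exponent p l : 0 < l ->
  is_derive l 1 (fun l => p `^ l) (ln p * p `^ l).
Proof.
move=> l0; have [->|p0] := eqVneq p 0.
  rewrite powR0 ?gt_eqF// mulr0.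
  (* Equality with 0 is only local: at exponent 0 the power of 0 is 1. *)
  apply: (@near_eq_is_derive R R R (cst 0)).
  near=> x => /=.
  rewrite powR0// gt_eqF//.
  by near: x; exact: lt_nbhsr.
have -> : (fun l => p `^ l) = (fun l => expR (l * ln p)).
  by apply/funext => x; rewrite /powR (negbTE p0).
rewrite /powR (negbTE p0).
by apply: is_derive_eq; rewrite /GRing.scale/=; ring.
Unshelve. all: by end_near. Qed.

Lemma is_derive_powR_defect k p l : 0 < l ->
  is_derive l 1 (fun l => powR_defect k l p) (powR_defect k.+1 l p).
Proof.
move=> l0; have dp := is_derive_powR_exponent p l0.
rewrite /powR_defect; apply: is_derive_eq.
by rewrite /GRing.scale/= mulr0n exprS; ring.
Qed.

(** A rearrangement of [e^x >= 1 + x]. With [x = - ln p] it trades one factor of the logarithm for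
    [1 - p]. *)
Let one_sub_expRN_ge x : 0 <= x -> x <= (1 + x) * (1 - expR (- x)).
Proof.
move=> x0; have := expR_ge1Dx x; have := expRxMexpNx_1 x; have := expR_gt0 (- x).
nra.
Qed.

Let exprn_expRN_le c x j : 0 < c -> 0 <= x ->
  x ^+ j * expR (- (c * x)) <= j`!%:R / c ^+ j.
Proof.
move=> c0 x0; have cx0 : 0 <= c * x by rewrite mulr_ge0// ltW.
have H : (c * x) ^+ j <= j`!%:R * expR (c * x).
  case: j => [|j]; first by rewrite expr0 fact0 mul1r -[leLHS](expR0 R) ler_expR.
  rewrite -ler_pdivrMl ?ltr0n ?fact_gt0// mulrC.
  by have := expR_ge1Dxn j cx0; lra.
rewrite ler_pdivlMr ?exprn_gt0// expRN mulrAC -exprMn mulrC (mulrC x).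
by rewrite mulrC ler_pdivrMr ?expR_gt0.
Qed.

(** For [k >= 1] and [L = - ln p], one factor [L] of [L^k e^(-c L)] becomes [(1 + L) (1 - p)],
    leaving [L^(k-1) e^(-c L)] and [L^k e^(-c L)], both bounded. For [k = 0], [1 - p^l] is at most
    both 1 and [d L]. *)
Lemma powR_defect_bound k c d : 0 < c -> c <= d -> exists2 K, 0 <= K &
  forall l p, c <= l <= d -> p < 1 -> `|powR_defect k l p| <= K * (1 - p).
Proof.
move=> c0 cd; have d0 : 0 < d by apply: lt_le_trans cd.
have fc j : 0 <= j`!%:R / c ^+ j by rewrite divr_ge0 ?ler0n ?exprn_ge0// ltW.
pose K : R := 1 + d + (k.-1)`!%:R / c ^+ k.-1 + k`!%:R / c ^+ k.
exists K.
  by rewrite /K !addr_ge0// ltW.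
have K1 : 1 + d <= K by rewrite /K; have := fc k; have := fc k.-1; lra.
move=> l p /andP[cl ld] p1.
have l0 : 0 < l by apply: lt_le_trans cl.
(* Here [1 - p >= 1], while the default values make the defect 0 or 1. *)
have [p0|p0] := leP p 0.
  rewrite /powR_defect ln0//; case: k K K1 => [|k] K K1; last first.
    by rewrite expr0n/= mul0r subr0 normr0; nra.
  rewrite expr0 mul1r /=; move: p0; rewrite le_eqVlt => /predU1P[->|p0].
    by rewrite powR0 ?gt_eqF// !subr0 normr1; nra.
  by rewrite lt0_powR1// subrr normr0; nra.
pose L := - ln p; have L0 : 0 < L by rewrite oppr_gt0 ln_lt0// p0.
have pL : p = expR (- L) by rewrite /L opprK lnK ?posrE.
have powE : p `^ l = expR (- (l * L)) by rewrite /powR gt_eqF// /L mulrN opprK.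
have powc : p `^ l <= expR (- (c * L)) by rewrite powE ler_expR lerN2 ler_wpM2r// ltW.
have oneL := one_sub_expRN_ge (ltW L0); rewrite -pL in oneL.
case: k @K K1 => [|k] K K1.
  rewrite /powR_defect expr0 mul1r /=.
  have := expR_ge1Dx (- (l * L)); rewrite powE => h1.
  have h2 := expR_gt0 (- (l * L)).
  have lL : 0 < l * L by rewrite mulr_gt0.
  have h3 : expR (- (l * L)) <= 1 by rewrite -[leRHS](expR0 R) ler_expR; lra.
  rewrite ger0_norm ?subr_ge0//.
  apply: (@le_trans _ _ ((1 + d) * (1 - p))); last by rewrite ler_wpM2r//; lra.
  have : 1 - expR (- (l * L)) <= 1 by lra.
  have : 1 - expR (- (l * L)) <= d * L by have : l * L <= d * L by [nra|]; lra.
  set m := 1 - expR _ => m1 m2.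
  suff : m * (1 + L) <= (1 + d) * (1 - p) * (1 + L) by rewrite ler_pM2r//; lra.
  nra.
rewrite /powR_defect sub0r normrN normrM normrX ler0_norm ?ln_le0 ?(ltW p1)// -/L.
rewrite (ger0_norm (powR_ge0 _ _)).
apply: (@le_trans _ _ (L ^+ k.+1 * expR (- (c * L)))).
  by rewrite ler_wpM2l// exprn_ge0// ltW.
have b1 := exprn_expRN_le k c0 (ltW L0).
have b2 := exprn_expRN_le k.+1 c0 (ltW L0).
apply: (@le_trans _ _ (L ^+ k * expR (- (c * L)) * ((1 + L) * (1 - p)))).
  rewrite exprSr mulrAC ler_wpM2l// mulr_ge0 ?expR_ge0// exprn_ge0// ltW//.
have -> : L ^+ k * expR (- (c * L)) * ((1 + L) * (1 - p)) =
  (L ^+ k * expR (- (c * L)) + L ^+ k.+1 * expR (- (c * L))) * (1 - p).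
  by rewrite exprSr; ring.
by rewrite ler_wpM2r /K/=; lra.
Qed.

Lemma integrable_inv_1Dsqr : mu.-integrable (`]0, +oo[%classic : set R)
  (EFin \o (fun t => (1 + t ^+ 2)^-1)).
Proof.
apply: (@half_line_integrable _ _ atan (pi / 2)) => // x x0.
- apply: cvgV; first by rewrite gt_eqF// ltr_wpDr ?sqr_ge0.
  by apply: cvgD; [exact: cvg_cst|exact: exprn_continuous].
- by rewrite invr_ge0 addr_ge0 ?sqr_ge0.
- by rewrite ler_norml !ltW ?atan_ltpi2 ?atan_gtNpi2.
Qed.

Variable f : R -> R.
Hypothesis mf : measurable_fun setT f.
Variable C : R.
Hypothesis f1 : forall t, 0 < t -> f t < 1.
Hypothesis fC : forall t, 0 < t -> 1 - f t <= C * t ^+ 2.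

Let C0 : 0 <= C.
Proof. by have := f1 ltr01; have := fC ltr01; rewrite expr1n mulr1; lra. Qed.

Definition powR_defect_int k l := \int[mu]_(t in `]0, +oo[)
  (powR_defect k l (f t) / (t ^+ 2 * (t ^+ 2 + 4))).

(** After [t^2] cancels, [1 / (t^2 + 4) <= 1 / (1 + t^2)], whose primitive is arctan. *)
Let integrand_bound k c d : 0 < c -> c <= d -> exists2 K, 0 <= K &
  forall l t, c <= l <= d -> 0 < t ->
  `|powR_defect k l (f t) / (t ^+ 2 * (t ^+ 2 + 4))| <= K * (1 + t ^+ 2)^-1.
Proof.
move=> c0 cd; have [K K0 HK] := powR_defect_bound k c0 cd.
exists (K * C); first exact: mulr_ge0.
move=> l t ld t0; have t2 : 0 < t ^+ 2 by rewrite exprn_gt0.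
have w0 : 0 < t ^+ 2 * (t ^+ 2 + 4) by rewrite mulr_gt0//; lra.
rewrite normf_div (gtr0_norm w0) ler_pdivrMr//.
apply: (le_trans (HK _ _ ld (f1 t0))).
rewrite [leRHS](_ : _ = K * (C * ((1 + t ^+ 2)^-1 * (t ^+ 2 * (t ^+ 2 + 4))))); last by rewrite !mulrA.
apply: ler_wpM2l => //.
apply: (le_trans (fC t0)); apply: ler_wpM2l => //.
rewrite mulrC ler_pdivlMr; last lra.
by rewrite ler_wpM2l ?(ltW t2)//; lra.
Qed.

Let integrable_integrand k l : 0 < l ->
  mu.-integrable (`]0, +oo[%classic : set R)
    (EFin \o (fun t => powR_defect k l (f t) / (t ^+ 2 * (t ^+ 2 + 4)))).
Proof.
move=> l0; have [K K0 HK] := integrand_bound k l0 (lexx l).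
apply: (@le_integrable _ _ _ mu _ mI _
  (fun x => (K%:E * (EFin \o (fun t => (1 + t ^+ 2)^-1)%R) x)%E)).
- apply/measurable_EFinP; apply: measurable_funM; last first.
    apply: continuous_gt0_measurable => t t0.
    have t2 : 0 < t ^+ 2 by rewrite exprn_gt0.
    apply: cvgV; first by rewrite gt_eqF// mulr_gt0//; lra.
    apply: cvgM; first exact: exprn_continuous.
    by apply: cvgD; [exact: exprn_continuous|exact: cvg_cst].
  apply: measurable_funTS; apply: measurable_funB; first exact: measurable_cst.
  apply: measurable_funM.
    by apply: measurable_funX; apply: measurableT_comp mf; exact: measurable_ln.
  by apply: (measurableT_comp (measurable_powR l)).
- move=> t /=; rewrite in_itv/= andbT => t0; rewrite lee_fin.
  by apply: le_trans (ler_norm _); apply: HK => //; rewrite lexx.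
- apply: (@integrableZl _ _ _ mu _ mI K); exact: integrable_inv_1Dsqr.
Qed.

Lemma is_derive_powR_defect_int k l : 0 < l ->
  is_derive l 1 (powR_defect_int k) (powR_defect_int k.+1 l).
Proof.
move=> l0.
(* Domination is uniform only for exponents bounded away from 0, hence the neighbourhood []l / 2, 2
   l[]. *)
have c0 : 0 < l / 2 by lra.
have cd : l / 2 <= 2 * l by lra.
have [K K0 HK] := integrand_bound k.+1 c0 cd.
have lI : `]l / 2, 2 * l[%classic l by rewrite /= in_itv/=; apply/andP; split; lra.
pose F (l t : R) : R := powR_defect k l (f t) / (t ^+ 2 * (t ^+ 2 + 4)).
have dF x t : `]l / 2, 2 * l[%classic x ->
    is_derive x 1 (F^~ t) (powR_defect k.+1 x (f t) / (t ^+ 2 * (t ^+ 2 + 4))).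
  rewrite /= in_itv/= => /andP[x0 _].
  have dd := is_derive_powR_defect k (f t) (lt_trans c0 x0).
  by apply: is_derive_eq; rewrite /GRing.scale/=; ring.
have d1F x t : `]l / 2, 2 * l[%classic x ->
    partial1of2 F x t = powR_defect k.+1 x (f t) / (t ^+ 2 * (t ^+ 2 + 4)).
  by move=> Ix; rewrite /partial1of2 derive1E; have [_ ->] := dF x t Ix.
have intF x : `]l / 2, 2 * l[%classic x ->
    mu.-integrable (`]0, +oo[%classic : set R) (EFin \o F x).
  rewrite /= in_itv/= => /andP[x0 _]; apply: integrable_integrand.
  exact: lt_trans x0.
have derF x t : `]l / 2, 2 * l[%classic x -> (`]0, +oo[%classic : set R) t ->
    derivable (F^~ t) x 1.
  by move=> Ix _; have [] := dF x t Ix.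
pose G t := K * (1 + t ^+ 2)^-1.
have G0 t : 0 <= G t by rewrite mulr_ge0// invr_ge0 addr_ge0 ?sqr_ge0.
have intG : mu.-integrable (`]0, +oo[%classic : set R) (EFin \o G).
  exact: (@integrableZl _ _ _ mu _ mI K _ integrable_inv_1Dsqr).
have G_ub x t : `]l / 2, 2 * l[%classic x -> (`]0, +oo[%classic : set R) t ->
    `|partial1of2 F x t| <= G t.
  move=> Ix; rewrite d1F//=; move: Ix; rewrite /= !in_itv/= andbT => /andP[/ltW x0 /ltW x1] t0.
  by apply: HK => //; rewrite x0.
apply: DeriveDef.
  exact: (@derivable_under_integral R _ _ mu F _ mI _ _ _ lI intF derF G G0 intG G_ub).
rewrite -derive1E.
rewrite [LHS](@differentiation_under_integral R _ _ mu F _ mI _ _ _ lI intF derF G G0 intG G_ub).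
by apply: eq_Rintegral => t _; rewrite d1F.
Qed.

Lemma powR_defect_int_sign k l : 0 < l -> 0 < (-1) ^+ k * powR_defect_int k.+1 l.
Proof.
move=> l0; rewrite /powR_defect_int -RintegralZl//; last exact: integrable_integrand.
have int := @integrableZl _ _ _ mu _ mI ((-1) ^+ k) _ (integrable_integrand k.+1 l0).
have signE t : (-1) ^+ k * (powR_defect k.+1 l (f t) / (t ^+ 2 * (t ^+ 2 + 4))) =
  (- ln (f t)) ^+ k.+1 * f t `^ l / (t ^+ 2 * (t ^+ 2 + 4)).
  rewrite /powR_defect /= mulr0n sub0r [in RHS]exprNn [(-1) ^+ k.+1]exprS; ring.
have w0 t : 0 < t -> 0 < t ^+ 2 * (t ^+ 2 + 4).
  by move=> t0; have := exprn_gt0 2 t0; nra.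
(* For [t < 1 / (1 + C)], [C t^2 <= C t < 1], so [f t > 0] and the integrand is strictly positive
   there. *)
have e0 : 0 < (1 + C)^-1 by rewrite invr_gt0; have := C0; lra.
apply: (half_line_Rintegral_gt0 e0 int) => t.
- move=> t0; rewrite signE mulr_ge0 ?invr_ge0 ?(ltW (w0 _ t0))//.
  by rewrite mulr_ge0 ?powR_ge0// exprn_ge0// oppr_ge0 ln_le0// ltW// f1.
- move=> /andP[t0 te]; rewrite signE.
  have fp : 0 < f t.
    have := fC t0; have tC : t * (1 + C) < 1 by rewrite -ltr_pdivlMr ?div1r//; have := C0; lra.
    have := C0; have t1 : t < 1 by have := C0; nra.
    have : C * t ^+ 2 <= C * t by apply: ler_wpM2l; [exact: C0|nra].
    lra.
  rewrite divr_gt0 ?w0// mulr_gt0 ?powR_gt0// exprn_gt0// oppr_gt0 ln_lt0// fp/=.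
  exact: f1.
Qed.

End power_integral.

(** * Bounds on phi and derivatives of calM *)

Section phi_bounds.
Context {R : realType}.
Implicit Types (l t x : R) (k : nat).

Lemma measurable_phi : measurable_fun setT (@phi R).
Proof.
apply: measurable_funM.
  apply: continuous_measurable_fun => t.
  apply: cvgM; first exact: cvg_cst.
  have cx : {for t, continuous (fun t : R => pi * t / 2)}.
    by apply: cvgM; [apply: cvgM; [exact: cvg_cst|exact: cvg_id]|exact: cvg_cst].
  apply: cvgV; first by rewrite gt_eqF// addr_gt0 ?expR_gt0.
  apply: cvgD.
    by apply: (continuous_comp cx); exact: continuous_expR.
  apply: (continuous_comp (cvgN cx)); exact: continuous_expR.
apply: measurable_funD; first exact: measurable_cst.
apply: measurable_funM.
  apply: continuous_measurable_fun => t.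
  by apply: cvgM; [exact: exprn_continuous|exact: cvg_cst].
apply: (measurableT_comp measurable_digamma_diff).
by apply: continuous_measurable_fun => t; apply: cvgM; [exact: cvg_id|exact: cvg_cst].
Qed.

Let phi_pos_part t : exists2 D : R, `|D| <= 3 / 2 &
  phi t = 2 / (expR (pi * t / 2) + expR (- (pi * t / 2))) * (1 + t ^+ 2 / 2 * D).
Proof. by eexists; first exact: digamma_diff_bound (t / 4). Qed.

(* [cosh (pi t / 2) >= 1 + (pi t / 2) ^ 2 / 2 >= 1 + t ^ 2]. *)
Lemma phi_lt1 t : 0 < t -> phi t < 1.
Proof.
move=> t0; have [D] := phi_pos_part t; rewrite ler_norml => /andP[_ D1] ->.
have := expR_addN_ge (pi * t / 2).
set S := expR _ + _ => HS.
have t2 : 0 < t ^+ 2 by rewrite exprn_gt0.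
have p8 : 8 <= pi ^+ 2 :> R := pi_sqr_ge8.
have H : 8 * t ^+ 2 <= pi ^+ 2 * t ^+ 2 by rewrite ler_wpM2r// ltW.
have E : (pi * t / 2) ^+ 2 = pi ^+ 2 * t ^+ 2 / 4 by field.
have S0 : 0 < S by rewrite E in HS; lra.
rewrite mulrAC ltr_pdivrMr// mul1r.
rewrite E in HS; nra.
Qed.

(** With [S = 2 cosh x], the Taylor bounds at [x] and [-x] add up to [S - 2 <= 2 x^2 S], so dividing
    by [S] leaves [2 x^2 = pi^2 t^2 / 2]. The summand 3 / 4 comes from [D >= -3 / 2] and
    [S >= 2]. *)
Lemma one_sub_phi_le t : 1 - phi t <= (pi ^+ 2 / 2 + 3 / 4) * t ^+ 2.
Proof.
have [D] := phi_pos_part t; rewrite ler_norml => /andP[D1 _] ->.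
set x := pi * t / 2.
have h1 := expR_taylor1 x; have h2 := expR_taylor1 (- x).
have h3 := expR_normr_le x; have h4 := expR_addN_ge x.
rewrite normrN sqrrN in h2; rewrite !ler_norml in h1 h2.
have /andP[_ k1] := h1; have /andP[_ k2] := h2.
set S := expR x + expR (- x) in h3 h4 *.
have x2 : 0 <= x ^+ 2 by rewrite sqr_ge0.
have t2 : 0 <= t ^+ 2 by rewrite sqr_ge0.
have S2 : 2 <= S by lra.
have E : pi ^+ 2 * t ^+ 2 = 4 * x ^+ 2 by rewrite /x; field.
have k3 : S - 2 <= 2 * x ^+ 2 * S.
  have := ler_wpM2l x2 h3; rewrite /S in h3 *; lra.
have -> : 1 - 2 / S * (1 + t ^+ 2 / 2 * D) = (S - 2 - t ^+ 2 * D) / S.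
  by field; rewrite gt_eqF//; lra.
rewrite ler_pdivrMr; last lra.
have -> : (pi ^+ 2 / 2 + 3 / 4) * t ^+ 2 = 2 * x ^+ 2 + 3 / 4 * t ^+ 2.
  by rewrite mulrDl mulrAC E; field.
have : - (t ^+ 2 * D) <= 3 / 2 * t ^+ 2 by nra.
have : 2 * (3 / 4 * t ^+ 2) <= S * (3 / 4 * t ^+ 2) by rewrite ler_wpM2r//; lra.
lra.
Qed.

Let I k l : R := powR_defect_int (@phi R) k l.

Lemma calM_powR_defect_int : @calM R = (fun l => 4 / pi * I 0 l).
Proof.
apply/funext => l; rewrite /calM /I /powR_defect_int; congr (_ * _).
by apply: eq_Rintegral => t _; rewrite /powR_defect expr0 mul1r.
Qed.

(** The formula for the [k]-th derivative is known only on [l > 0]; since this set is open, local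
    equality suffices to differentiate once more. *)
Lemma is_derive_derive1n_calM k l : 0 < l ->
  is_derive l 1 (derive1n k (@calM R)) (4 / pi * I k.+1 l) /\
  derive1n k (@calM R) l = 4 / pi * I k l.
Proof.
elim: k l => [|k IH] l l0.
  rewrite /derive1n /= calM_powR_defect_int; split => //.
  have dI := is_derive_powR_defect_int measurable_phi phi_lt1 (fun t _ => one_sub_phi_le t) 0 l0.
  exact: is_deriveZ.
have E x : 0 < x -> derive1n k.+1 (@calM R) x = 4 / pi * I k.+1 x.
  by move=> x0; rewrite derive1nS derive1E; have [[_ ->] _] := IH x x0.
split; last exact: E.
have dI := is_derive_powR_defect_int measurable_phi phi_lt1 (fun t _ => one_sub_phi_le t) k.+1 l0.
apply: (@near_eq_is_derive _ _ _ (fun l => 4 / pi * I k.+1 l)).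
  near=> x; rewrite E//.
  by near: x; exact: lt_nbhsr.
Unshelve. all: by end_near. Qed.

End phi_bounds.

(** [derive1] takes some value even where the difference quotient has no limit, so the existence of
    the [k]-th derivative is a separate conjunct. *)
Theorem proposition5p1 (R : realType) (k : nat) (lambda : R)
    (hk : (1 <= k)%N) (hlambda : 0 < lambda) :
  derivable (derive1n k.-1 (@calM R)) lambda 1 /\
  0 < (-1) ^+ k.-1 * derive1n k (@calM R) lambda.
Proof.
case: k hk => // k _; rewrite -[k.+1.-1]/k; split.
  by have [[]] := is_derive_derive1n_calM k hlambda.
have [_ ->] := is_derive_derive1n_calM k.+1 hlambda.
rewrite mulrCA mulr_gt0 ?divr_gt0 ?pi_gt0//.
exact: (powR_defect_int_sign measurable_phi phi_lt1 (fun t _ => one_sub_phi_le t)).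
Qed.
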